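(* Let $n=1$, $\beta=-1$, $m=0$, $c>0$, and $h(x)=\Gamma(\frac12)(c^2+x^2)^{-1/2}$ for $x\in\mathbb{R}$. Let $b_0>0$, $\gamma_1=2$, $\rho=1$, $\Delta_0=1$, and put $$C=\max\left\{\frac{2\rho}{c}\,e^{2\gamma_1},\ \frac{2}{3b_0}\right\},\qquad \delta_0=\frac{1}{6C\gamma_1},\qquad \lambda=\left(\frac23\right)^{\frac{1}{6C\gamma_1}}.$$ Let $\sigma>0$ and $f\in B_\sigma$, let $E\subset\mathbb{R}$ be any interval of length $b_0$, let $X=\{x_1,\dots,x_N\}$ be a finite subset of $E$, and let $s(x)=\sum_{i=1}^N c_i h(x-x_i)$ be the function with $s(x_j)=f(x_j)$ for $j=1,\dots,N$. Let $\delta=\sup_{y\in E}\inf_{x\in X}|y-x|$. If $0<\delta\le\delta_0$, then for all $x\in E$, $$|f(x)-s(x)|\le\sqrt{2\pi}\,\sqrt{\Delta_0}\;\lambda^{\frac1\delta}\left\{\frac{A+B}{c}\right\}^{1/2},$$ where $$A=\frac{1}{\mathcal{K}_0(1)}\int_{|\xi|\le\frac1c}|\hat f(\xi)|^2\,d\xi,$$ $$B=\frac{2\sqrt3\,\Gamma(\frac12)}{\sqrt\pi}\int_{\frac1c<|\xi|\le\sigma}|\hat f(\xi)|^2\sqrt{c|\xi|}\,e^{c|\xi|}\,d\xi\quad\text{if }\tfrac1c\le\sigma,$$ and $B=0$ if $\frac1c\ge\sigma$.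
   Context: $\Gamma$ is the gamma function and $\mathcal{K}_0$ is the modified Bessel function of the second kind of order $0$. Band-limited functions: $B_\sigma=\{f\in L^2(\mathbb{R}): \hat f(\xi)=0 \text{ if } |\xi|>\sigma\}$, where $\hat f(\xi)=(2\pi)^{-1/2}\int_{\mathbb{R}} f(x)e^{-ix\xi}\,dx$ is the (unitary) Fourier transform on $L^2(\mathbb{R})$. An element of $B_\sigma$ is identified with its continuous representative. Since $m=0$, the interpolant $s$ has no polynomial part. *)

(* Defs.v *)
From HB Require Import structures.
From mathcomp Require Import all_boot all_order all_algebra.
From mathcomp Require Import all_classical all_reals all_analysis.
From mathcomp Require Export complex.

Set Implicit Arguments.
Unset Strict Implicit.
Unset Printing Implicit Defensive.

Import Order.TTheory GRing.Theory Num.Theory.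
Import numFieldNormedType.Exports.

Local Open Scope classical_set_scope.
Local Open Scope ring_scope.

Section SpecialFunctions.
Context {R : realType}.
Implicit Types s x nu t : R.

Definition Gamma s : R :=
  \int[lebesgue_measure]_(t in `]0, +oo[) (t `^ (s - 1) * expR (- t)).

Definition cosh t : R := (expR t + expR (- t)) / 2.

(* Modified Bessel function of the second kind, for x > 0. *)
Definition besselK nu x : R :=
  \int[lebesgue_measure]_(t in `[0, +oo[) (expR (- (x * cosh t)) * cosh (nu * t)).

End SpecialFunctions.

(* MathComp-Analysis integrates only real and extended-real functions, so
   measurability, continuity and integrals of complex-valued functions are
   taken on real and imaginary parts. *)
Section Fourier.
Context {R : realType}.
Implicit Types f g : R -> R[i].

Definition ccontinuous f : Prop :=
  continuous (fun x => complex.Re (f x)) /\ continuous (fun x => complex.Im (f x)).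

Definition cmeasurable f : Prop :=
  measurable_fun setT (fun x => complex.Re (f x)) /\
  measurable_fun setT (fun x => complex.Im (f x)).

Definition cintegral (D : set R) f : R[i] :=
  Complex (\int[lebesgue_measure]_(x in D) complex.Re (f x))
          (\int[lebesgue_measure]_(x in D) complex.Im (f x)).

Definition sqnormL2 f : \bar R :=
  (\int[lebesgue_measure]_x ((Normc.normc (f x)) ^+ 2)%:E)%E.

Definition inL2 f : Prop := cmeasurable f /\ (sqnormL2 f < +oo)%E.

Definition expi (t : R) : R[i] := Complex (cos t) (sin t).

Definition trunc_fourier f (T : R) (xi : R) : R[i] :=
  real_complex R (Num.sqrt (2 * pi))^-1 *
  cintegral `[- T, T] (fun x => f x * expi (- (x * xi))).

(* fhat represents the unitary Fourier(-Plancherel) transform of f in L^2: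
   the integral defining it need not converge, and is the limit in the mean
   of the integrals over [-T, T]. *)
Definition is_fourier f (fhat : R -> R[i]) : Prop :=
  [/\ inL2 f, inL2 fhat &
      sqnormL2 (fun xi => trunc_fourier f T xi - fhat xi) @[T --> +oo] --> 0%E].

(* The space B_sigma, each element being given by its continuous
   representative. *)
Definition band_limited (sigma : R) f : Prop :=
  [/\ ccontinuous f, inL2 f &
      exists2 fhat, is_fourier f fhat &
        {ae lebesgue_measure, forall xi : R, sigma < `|xi| -> fhat xi = 0}].

End Fourier.

Section Interpolation.
Context {R : realType}.

Definition interval_of_length (b : R) (E : set R) : Prop :=
  exists (a : R) (l r : bool), E = [set` Interval (BSide l a) (BSide r (a + b))].

Definition fill_distance (X E : set R) : R :=
  sup [set inf [set `|y - x| | x in X] | y in E].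

Definition kernel_sum (h : R -> R) N (x : 'I_N -> R) (a : 'I_N -> R[i])
    (t : R) : R[i] :=
  \sum_(i < N) a i * real_complex R (h (t - x i)).

Definition imq (c x : R) : R :=
  Gamma (1 / 2) * (c ^+ 2 + x ^+ 2) `^ (- (1 / 2)).

End Interpolation.

Section ErrorTerms.
Context {R : realType}.
Implicit Types (c sigma : R) (fhat : R -> R[i]).

Definition termA c fhat : R :=
  1 / besselK 0 1 *
  \int[lebesgue_measure]_(xi in [set xi : R | `|xi| <= 1 / c])
    (Normc.normc (fhat xi)) ^+ 2.

Definition termB c sigma fhat : R :=
  if 1 / c <= sigma then
    2 * Num.sqrt 3 * Gamma (1 / 2) / Num.sqrt pi *
    \int[lebesgue_measure]_(xi in [set xi : R | 1 / c < `|xi| <= sigma])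
      ((Normc.normc (fhat xi)) ^+ 2 * Num.sqrt (c * `|xi|) * expR (c * `|xi|))
  else 0.

End ErrorTerms.

(* Main.v *)
Require Import Defs.
From mathcomp Require Import all_boot all_order all_algebra.
From mathcomp Require Import all_classical all_reals all_analysis.
From mathcomp Require Import measurable_realfun zify ring lra.

(** Averaging the Poisson kernels e/(e^2 + x^2), e = c cosh t, over t gives
    the Fourier representation h(x) = (Gamma(1/2)/pi) int K_0(c|xi|) e^{i x xi}.
    Hence, by Cauchy-Schwarz with the weight K_0(c|xi|), a functional
    f |-> sum_i v_i f(p_i) on B_sigma is bounded by a weighted norm of fhat
    times the square root of sum_{i,j} v_i v_j h(p_i - p_j); the bound
    K_0(r) >= e^{-2-r} / sqrt r, r >= 1, controls the weighted norm by A and B.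
    The passage from f to fhat uses no inversion theorem: f is tested against
    Poisson kernels, whose Fourier transforms e^{-e|xi|} are explicit, at a scale
    e small enough for them to act as an approximate identity.

    The interpolation error at t is such a functional, and its weights minimize
    the quadratic form, so they may be replaced by those of the Lagrange
    interpolation at any k nodes of X close to t.  An interval of length
    D = 4 k delta around t, with k between 1/(12 C delta) and 1/(6 C delta),
    splits into k cells of length 4 delta, each of which contains a node.  By
    Rolle's theorem the Lagrange error of cos (xi x + phi) is at most
    (D|xi|)^k / k!, so the quadratic form is O((4D/c)^{2k}), and
    D <= 2/(3C) <= c e^{-4} / 3. *)

Import Order.TTheory GRing.Theory Num.Theory.
Import numFieldNormedType.Exports.

Local Open Scope classical_set_scope.
Local Open Scope ring_scope.

Set Implicit Arguments.
Unset Strict Implicit.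
Unset Printing Implicit Defensive.

(** * Elementary integrals *)

(** Two difficulties shape the estimates. The transform [fhat] is only a limit in the mean:
    [trunc_fourier f T - fhat] is small in plain L^2, whereas the reciprocal of K_0 grows
    exponentially. The pairing is therefore split. The part with [fhat] uses the Bessel weight; the
    part with the difference uses a constant weight, and there the factor e^{-e|xi|} makes the
    bounded exponential sum square integrable. The scale e has to be fixed before T, since the cost
    of the second part contains 1/e. Cauchy-Schwarz is used in the form 2ab <= eta a^2 + b^2/eta,
    which holds pointwise and can be integrated; eta is optimized afterwards.

    Moreover, K_0(r) >= e^{-2-r} / sqrt r reaches B only up to a factor, here bounded by e^3. The
    constant C leaves room for it: C contains e^4, so 4D/c <= (2/3) * 2e^{-4}, and the spare factor
    (2e^{-4})^{2k}, k >= 1, absorbs e^3.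

    Complex values are handled by projecting on the direction of the error at t, so that all
    functionals have real weights. *)

Section BasicIntegrals.
Context {R : realType}.
Notation mu := (@lebesgue_measure R).
Implicit Types (a b x y p : R) (g F : R -> R).

Lemma ge0_integralT_half g : continuous g -> (forall x, 0 <= g x) ->
  (\int[mu]_x (g x)%:E = \int[mu]_(x in `[0%R, +oo[) (g x + g (- x))%:E)%E.
Proof.
move=> cg g0.
have mg : measurable_fun setT g by exact: continuous_measurable_fun.
have mgN : measurable_fun setT (g \o -%R) by apply: measurableT_comp.
rewrite -(setUv `]-oo, 0%R]) ge0_integral_setU//=; last 4 first.
- exact: measurableC.
- by apply: measurable_funTS; exact/measurable_EFinP.
- by move=> x _; rewrite lee_fin.
- by rewrite disj_set2E setICr.
have -> : (\int[mu]_(x in `]-oo, 0%R]) (g x)%:E =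
           \int[mu]_(x in `[0%R, +oo[) (g (- x))%:E)%E.
  rewrite -[in LHS]oppr0 ge0_integration_by_substitutionNy//.
  by apply: continuous_subspaceT.
rewrite setCitvl integral_itv_obnd_cbnd; last first.
  by apply: measurable_funTS; exact/measurable_EFinP.
under [RHS]eq_integral do rewrite EFinD.
rewrite ge0_integralD//=; [by rewrite addeC|..];
  by [move=> x _; rewrite lee_fin| apply: measurable_funTS; exact/measurable_EFinP].
Qed.

Lemma ge0_FTC2y g F (l v : R) : continuous g -> (forall x, 0 <= x -> 0 <= g x) ->
  (forall x, is_derive x 1 F (g x)) -> F x @[x --> +oo] --> l ->
  l - F 0 = v ->
  (\int[mu]_(x in `[0%R, +oo[) (g x)%:E = v%:E)%E.
Proof.
move=> cg g0 dF Fl <-; rewrite (@ge0_continuous_FTC2y _ g F 0 l)//.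
- by apply: continuous_subspaceT.
- apply: cvg_at_right_filter; apply: differentiable_continuous.
  by apply/derivable1_diffP; case: (dF 0).
- by move=> x _; rewrite derive1E; apply: derive_val.
Qed.

Lemma derivable_cts F : (forall x, derivable F x 1) -> continuous F.
Proof. by move=> dF x; apply/differentiable_continuous/derivable1_diffP/dF. Qed.

Lemma cvg_expRN_lin a : 0 < a -> expR (- (a * x)) @[x --> +oo] --> (0 : R).
Proof.
move=> a0; apply: (cvg_comp (fun x => a * x) (fun x => expR (- x))).
  exact: gt0_cvgMry.
exact: cvgr_expR.
Qed.

Lemma integral_expRN_lin a : 0 < a ->
  (\int[mu]_(x in `[0%R, +oo[) (expR (- (a * x)))%:E = (a^-1)%:E)%E.
Proof.
move=> a0; apply: (@ge0_FTC2y _ (fun x => - a^-1 * expR (- (a * x))) 0).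
- by apply: derivable_cts => x; apply: ex_derive.
- by move=> x _; exact: expR_ge0.
- move=> x; apply: is_derive_eq; rewrite /GRing.scale /=; field; exact: lt0r_neq0.
- by rewrite -(mulr0 (- a^-1)); apply: cvgM; [exact: cvg_cst|exact: cvg_expRN_lin].
- by rewrite mulr0 oppr0 expR0 mulr1 sub0r opprK.
Qed.

Lemma continuous_expRN_abs a : continuous (fun x => expR (- (a * `|x|))).
Proof.
move=> x; apply: (@continuous_comp _ _ _ (fun x => - (a * `|x|)) expR); last first.
  exact: continuous_expR.
by apply: cvgN; apply: cvgM; [exact: cvg_cst|exact: cvg_norm].
Qed.

Lemma normr_cos_le1 x : `|cos x| <= 1.
Proof. by rewrite ler_norml cos_geN1 cos_le1. Qed.

Lemma normr_sin_le1 x : `|sin x| <= 1.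
Proof. by rewrite ler_norml sin_geN1 sin_le1. Qed.

Lemma normr_lin_cos_sin_le (al be s t : R) :
  `|al * cos s + be * sin t| <= `|al| + `|be|.
Proof.
apply: le_trans (ler_normD _ _) _; rewrite !normrM.
by apply: lerD; rewrite -[leRHS]mulr1 ler_wpM2l// ?normr_cos_le1 ?normr_sin_le1.
Qed.

(* Adding the constant M makes the integrand nonnegative, so that no
   integrability argument is needed to evaluate the improper integral. *)
Lemma integral_expRN_abs_osc a y (M al be : R) : 0 < a -> `|al| + `|be| <= M ->
  (\int[mu]_x (expR (- (a * `|x|)) *
      (M + (al * cos (y * x) + be * sin (y * x))))%:E =
   (2 * M / a + 2 * al * a / (a ^+ 2 + y ^+ 2))%:E)%E.
Proof.
move=> a0 alM.
have M0 s t : 0 <= M + (al * cos s + be * sin t).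
  have := normr_lin_cos_sin_le al be s t; rewrite ler_norml => /andP[h _].
  by rewrite -lerBlDl sub0r (le_trans _ h)// lerN2.
have D0 : a ^+ 2 + y ^+ 2 != 0.
  by rewrite lt0r_neq0// ltr_wpDr ?sqr_ge0// exprn_gt0.
have a00 : a != 0 by exact: lt0r_neq0.
rewrite ge0_integralT_half; last 2 first.
- move=> x; apply: cvgM; first exact: continuous_expRN_abs.
  apply: (@derivable_cts (fun x => M + (al * cos (y * x) + be * sin (y * x)))).
  by move=> z; apply: ex_derive.
- by move=> x; rewrite mulr_ge0// expR_ge0.
under eq_integral => x.
  rewrite inE /= in_itv /= andbT => x0.
  rewrite normrN ger0_norm// mulrN cosN sinN -mulrDr.
  (* The sine term is odd and cancels between x and -x. *)
  rewrite [X in (_ * X)%:E](_ : _ = 2 * (M + al * cos (y * x))); last by ring.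
  over.
apply: (@ge0_FTC2y _ (fun x => expR (- (a * x)) * (- (2 * M / a) +
    2 * al / (a ^+ 2 + y ^+ 2) * (y * sin (y * x) - a * cos (y * x)))) 0).
- by apply: derivable_cts => x; apply: ex_derive.
- move=> x _; rewrite mulr_ge0 ?expR_ge0// mulr_ge0//.
  by have := M0 (y * x) 0; rewrite sin0 mulr0 addr0.
- have dF k1 k2 x : is_derive x 1
      (fun x => expR (- (a * x)) * (k1 + k2 * (y * sin (y * x) - a * cos (y * x))))
      (expR (- (a * x)) * (k2 * (a ^+ 2 + y ^+ 2) * cos (y * x) - a * k1)).
    by apply: is_derive_eq; rewrite /GRing.scale /=; ring.
  by move=> x; apply: (is_derive_eq (dF _ _ x)); field; rewrite D0 a00.
- apply: norm_cvg0.
  pose K := `|2 * M / a| + `|2 * al / (a ^+ 2 + y ^+ 2)| * (`|y| + `|a|).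
  apply: (@squeeze_cvgr _ _ _ _ (fun=> 0) (fun x => expR (- (a * x)) * K)).
  + near=> x; rewrite normr_ge0 /= normrM ger0_norm ?expR_ge0// ler_wpM2l ?expR_ge0//.
    apply: le_trans (ler_normD _ _) _; rewrite normrN lerD2l normrM ler_wpM2l//.
    apply: le_trans (ler_normD _ _) _; rewrite normrN !normrM.
    by apply: lerD; rewrite -[leRHS]mulr1 ler_wpM2l// ?normr_cos_le1 ?normr_sin_le1.
  + exact: cvg_cst.
  + by rewrite -(mul0r K); apply: cvgM; [exact: cvg_expRN_lin|exact: cvg_cst].
- by rewrite !mulr0 oppr0 expR0 sin0 cos0; field; rewrite a00 D0.
Unshelve. all: by end_near.
Qed.

Lemma integral_atan a p : 0 < a ->
  (\int[mu]_x (a / (a ^+ 2 + (x - p) ^+ 2))%:E = pi%:E)%E.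
Proof.
move=> a0; have a00 : a != 0 by exact: lt0r_neq0.
have D0 t : 0 < a ^+ 2 + t ^+ 2 by rewrite ltr_wpDr ?sqr_ge0// exprn_gt0.
have ga x q : 0 <= a / (a ^+ 2 + (x - q) ^+ 2) by rewrite divr_ge0// ltW.
have dF q x : is_derive x 1 (fun x => atan ((x - q) / a)) (a / (a ^+ 2 + (x - q) ^+ 2)).
  apply: is_derive_eq; rewrite /GRing.scale /=.
  have := lt0r_neq0 (D0 (x - q)); move: (x - q) => t tD.
  by field; rewrite tD a00.
have cg q : continuous (fun x => a / (a ^+ 2 + (x - q) ^+ 2)).
  apply: derivable_cts => x.
  have ? := lt0r_neq0 (D0 (x - q)); apply: derivableM => //; apply: derivableV => //.
have cvgF q : (fun x => atan ((x - q) / a)) x @[x --> +oo] --> pi / 2.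
  apply: (cvg_comp (fun x => (x - q) / a) atan); last exact: cvgy_atan.
  apply: gt0_cvgMly; first by rewrite invr_gt0.
  exact: cvg_addrr.
rewrite ge0_integralT_half//.
transitivity (\int[mu]_(x in `[0%R, +oo[)
    (a / (a ^+ 2 + (x - p) ^+ 2) + a / (a ^+ 2 + (x - (- p)) ^+ 2))%:E)%E.
  by apply: eq_integral => x _; congr ((_ + _ / (_ + _))%:E); ring.
apply: (@ge0_FTC2y _ (fun x => atan ((x - p) / a) + atan ((x - (- p)) / a)) pi).
- by move=> x; apply: cvgD; exact: cg.
- by move=> x _; rewrite addr_ge0.
- by rewrite [X in _ --> X](splitr pi); apply: cvgD.
- by rewrite !sub0r opprK mulNr atanN addNr subr0.
Qed.

End BasicIntegrals.

(** * Fourier transform of e^{-a|x|} and the average of Poisson kernels over cosh *)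

Section Kernels.
Context {R : realType}.
Notation mu := (@lebesgue_measure R).
Implicit Types (a b c r t x y p : R).

Lemma integrable_expRN_abs a : 0 < a ->
  mu.-integrable setT (fun x => (expR (- (a * `|x|)))%:E).
Proof.
move=> a0; apply/integrableP; split.
  apply/measurable_EFinP; apply: continuous_measurable_fun.
  exact: continuous_expRN_abs.
under eq_integral do rewrite abse_EFin ger0_norm ?expR_ge0//.
have := @integral_expRN_abs_osc R a 0 1 0 0 a0.
rewrite normr0 addr0 ler01 => /(_ isT); rewrite (_ : (fun _ => _) =
  fun x => (expR (- (a * `|x|)))%:E); last first.
  by apply/funext => x; rewrite !mul0r !addr0 mulr1.
by move=> ->; exact: ltry.
Qed.

Lemma integrable_expRN_abs_osc a y (al be : R) : 0 < a ->
  mu.-integrable setT (fun x =>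
    (expR (- (a * `|x|)) * (al * cos (y * x) + be * sin (y * x)))%:E).
Proof.
move=> a0.
have i1 : mu.-integrable setT
    (fun x => ((`|al| + `|be|)%:E * (expR (- (a * `|x|)))%:E)%E).
  by apply: integrableZl => //; exact: integrable_expRN_abs.
apply: le_integrable i1 => //.
  apply/measurable_EFinP; apply: continuous_measurable_fun => x; apply: cvgM.
    exact: continuous_expRN_abs.
  apply: (@derivable_cts _ (fun x => al * cos (y * x) + be * sin (y * x))).
  by move=> z; apply: ex_derive.
move=> x _; rewrite -EFinM !abse_EFin lee_fin !normrM !(ger0_norm (expR_ge0 _)).
rewrite mulrC ler_wpM2r ?expR_ge0//.
by rewrite [leRHS]ger0_norm ?addr_ge0// normr_lin_cos_sin_le.
Qed.

Lemma Rintegral_expRN_abs_osc a y (al be : R) : 0 < a ->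
  \int[mu]_x (expR (- (a * `|x|)) * (al * cos (y * x) + be * sin (y * x))) =
  2 * al * a / (a ^+ 2 + y ^+ 2).
Proof.
move=> a0; pose M := `|al| + `|be|.
have iE := integrable_expRN_abs a0.
have iO := integrable_expRN_abs_osc y al be a0.
have E1 : \int[mu]_x expR (- (a * `|x|)) = 2 / a.
  have := @integral_expRN_abs_osc R a 0 1 0 0 a0.
  rewrite normr0 addr0 ler01 => /(_ isT) h; rewrite /Rintegral.
  rewrite (_ : (fun _ => _) = fun x => (expR (- (a * `|x|)) *
     (1 + (0 * cos (0 * x) + 0 * sin (0 * x))))%:E); last first.
    by apply/funext => x; rewrite !mul0r !addr0 mulr1.
  by rewrite h /= mulr1 mulr0 !mul0r addr0.
have := @integral_expRN_abs_osc R a y M al be a0 (lexx _).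
move=> /(congr1 fine) /=; rewrite -/(Rintegral _ _ _).
rewrite (_ : \int[mu]_x _ = M * \int[mu]_x expR (- (a * `|x|)) +
   \int[mu]_x (expR (- (a * `|x|)) * (al * cos (y * x) + be * sin (y * x)))).
  by rewrite E1 mulrCA mulrA => /addrI.
rewrite -RintegralZl// -RintegralD//.
  by apply: eq_Rintegral => x _; rewrite mulrDr [M * _]mulrC.
exact: (integrableZl _ M iE).
Qed.

Lemma cosh_ge1 t : 1 <= cosh t.
Proof.
rewrite /cosh; have := expR_ge1Dx t; have := expR_ge1Dx (- t); lra.
Qed.

Lemma cosh_gt0 t : 0 < cosh t.
Proof. exact: lt_le_trans ltr01 (cosh_ge1 t). Qed.

Lemma cosh0 : cosh 0 = 1 :> R.
Proof. by rewrite /cosh oppr0 expR0; field. Qed.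

Lemma cosh_ge_half t : t / 2 <= cosh t.
Proof. by rewrite /cosh; have := expR_ge1Dx t; have := expR_ge0 (- t); lra. Qed.

Lemma continuous_cosh : continuous (@cosh R).
Proof. by apply: derivable_cts => x; apply: ex_derive. Qed.

(** Since cosh t - 1 = (E - 1/E)^2 / 2 with E = e^{t/2}, it suffices that E - 1/E <= 2t; this
    follows from the tangent-line bounds for E and 1/E. *)
Lemma cosh_le t : 0 <= t <= 1 -> cosh t <= 1 + 2 * t ^+ 2.
Proof.
move=> /andP[t0 t1]; pose E := expR (t / 2); pose E' := expR (- (t / 2)).
have EE' : E * E' = 1 by rewrite /E /E' expRxMexpNx_1.
have hE : 1 + t / 2 <= E by exact: expR_ge1Dx.
have hE' : 1 - t / 2 <= E' by exact: expR_ge1Dx.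
have -> : cosh t = 1 + (E - E') ^+ 2 / 2.
  rewrite (_ : (E - E') ^+ 2 = E * E + E' * E' - 2 * (E * E')); last by ring.
  rewrite EE' /E /E' -!expRD /cosh -opprD -splitr; lra.
have E0 : 0 < E by exact: expR_gt0.
have EE : E - E' <= 2 * t by nra.
have : 0 <= E - E' by nra.
nra.
Qed.

(** With S^2 = c^2 + x^2, the identity cosh^2 = 1 + sinh^2 turns the denominator into S^2 + (c sinh
    t)^2, so arctan(c sinh t / S) / S is a primitive. *)
Lemma integral_cosh c x : 0 < c ->
  (\int[mu]_(t in `[0%R, +oo[) (c * cosh t / ((c * cosh t) ^+ 2 + x ^+ 2))%:E =
   (pi / 2 / Num.sqrt (c ^+ 2 + x ^+ 2))%:E)%E.
Proof.
move=> c0; set S := Num.sqrt _.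
have S2 : S ^+ 2 = c ^+ 2 + x ^+ 2 by rewrite sqr_sqrtr// addr_ge0 ?sqr_ge0.
have S0 : 0 < S by rewrite sqrtr_gt0 ltr_wpDr ?sqr_ge0// exprn_gt0.
have D0 t : 0 < (c * cosh t) ^+ 2 + x ^+ 2.
  by rewrite ltr_wpDr ?sqr_ge0// exprn_gt0// mulr_gt0// cosh_gt0.
apply: (@ge0_FTC2y _ _ (fun t => S^-1 * atan (c / S * ((expR t - expR (- t)) / 2)))
  (pi / 2 / S)).
- move=> t; apply: cvgM; first by apply: cvgM; [exact: cvg_cst|exact: continuous_cosh].
  apply: cvgV; first exact: lt0r_neq0.
  apply: (@derivable_cts _ (fun t => (c * cosh t) ^+ 2 + x ^+ 2)) => z.
  by rewrite /cosh; apply: ex_derive.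
- by move=> t _; rewrite divr_ge0// ?ltW// mulr_gt0// cosh_gt0.
- move=> t; apply: is_derive_eq; rewrite /GRing.scale /= /cosh.
  have := lt0r_neq0 (D0 t); rewrite /cosh.
  have : expR t * expR (- t) = 1 by rewrite expRxMexpNx_1.
  have := lt0r_neq0 S0; have := lt0r_neq0 c0.
  move: (expR t) (expR (- t)) => u v c00 S00 uv d0.
  have DE : (c * ((u + v) / 2)) ^+ 2 + x ^+ 2 = S ^+ 2 + (c * ((u - v) / 2)) ^+ 2.
    rewrite S2 (_ : c ^+ 2 = c ^+ 2 * (u * v)); last by rewrite uv mulr1.
    by field.
  rewrite (_ : 1 + _ = ((c * ((u + v) / 2)) ^+ 2 + x ^+ 2) / S ^+ 2); last first.
    by rewrite DE; field.
  move: d0; set D := (c * ((u + v) / 2)) ^+ 2 + _ => d0.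
  by field; rewrite ?d0 ?S00.
- rewrite [pi / 2 / S]mulrC; apply: cvgM; first exact: cvg_cst.
  apply: (cvg_comp (fun t => c / S * ((expR t - expR (- t)) / 2)) atan); last exact: cvgy_atan.
  apply: gt0_cvgMry; first by rewrite divr_gt0.
  apply: (ger_cvgy (f := fun t => 2^-1 * t)).
    near=> t; rewrite mulrC ler_wpM2r ?invr_ge0//.
    have : expR (- t) <= 1 by rewrite expR_le1 oppr_le0.
    by have := expR_ge1Dx t; lra.
  apply: gt0_cvgMry => //.
- by rewrite oppr0 subrr mul0r mulr0 atan0 mulr0 subr0.
Unshelve. all: by end_near.
Qed.

End Kernels.

(** * The Bessel function K_0 and Gamma (1/2) *)

Section BesselGamma.
Context {R : realType}.
Notation mu := (@lebesgue_measure R).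
Implicit Types (a b c r t x y p : R).

(** Extended-real form of K_0: it is +oo at r = 0, which occurs as c|x| at x = 0, and monotonicity
    and Tonelli apply to it without a finiteness condition. *)
Definition besselK0 r : \bar R :=
  (\int[mu]_(t in `[0%R, +oo[) (expR (- (r * cosh t)))%:E)%E.

Lemma besselKE r : besselK 0 r = fine (besselK0 r).
Proof.
rewrite /besselK /Rintegral /besselK0; congr fine.
by apply: eq_integral => t _; rewrite mul0r cosh0 mulr1.
Qed.

Lemma besselK0_ge0 r : (0 <= besselK0 r)%E.
Proof. by apply: integral_ge0 => t _; rewrite lee_fin expR_ge0. Qed.

Lemma measurable_expRN_cosh (D : set R) r :
  measurable_fun D (fun t => (expR (- (r * cosh t)))%:E).
Proof.
apply: measurable_funTS; apply/measurable_EFinP; apply: continuous_measurable_fun.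
by apply: derivable_cts => t; rewrite /cosh; apply: ex_derive.
Qed.

Lemma besselK0_lty r : 0 < r -> (besselK0 r < +oo)%E.
Proof.
move=> r0; have r20 : 0 < r / 2 by rewrite divr_gt0.
apply: (@le_lt_trans _ _ ((r / 2)^-1)%:E); last exact: ltry.
rewrite -(integral_expRN_lin r20); apply: ge0_le_integral => //.
- exact: measurable_expRN_cosh.
- apply: measurable_funTS; apply/measurable_EFinP; apply: continuous_measurable_fun.
  by apply: derivable_cts => t; apply: ex_derive.
move=> t _; rewrite lee_fin ler_expR lerN2 -mulrA ler_wpM2l ?(ltW r0)//.
by rewrite [2^-1 * t]mulrC cosh_ge_half.
Qed.

Lemma le_besselK0 r x : r <= x -> (besselK0 x <= besselK0 r)%E.
Proof.
move=> rx; apply: ge0_le_integral => //.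
- exact: measurable_expRN_cosh.
- exact: measurable_expRN_cosh.
by move=> t _; rewrite lee_fin ler_expR lerN2 ler_wpM2r// ltW// cosh_gt0.
Qed.

(* On [0, 1/sqrt r] the exponent r cosh t is at most r + 2. *)
Lemma besselK0_lower_bound r : 1 <= r ->
  ((expR (- (2 + r)) / Num.sqrt r)%:E <= besselK0 r)%E.
Proof.
move=> r1; have r0 : 0 < r by exact: lt_le_trans ltr01 r1.
have s0 : 0 < Num.sqrt r by rewrite sqrtr_gt0.
have s1 : 1 <= Num.sqrt r by rewrite -[leLHS]sqrtr1 ler_wsqrtr.
pose I : set R := `[0, (Num.sqrt r)^-1]%classic.
apply: (@le_trans _ _ (\int[mu]_(t in I) (expR (- (r * cosh t)))%:E)%E); last first.
  apply: ge0_subset_integral => //.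
  - exact: measurable_itv.
  - exact: measurable_expRN_cosh.
  - by move=> t; rewrite /I /= !in_itv /= => /andP[-> _].
have -> : (expR (- (2 + r)) / Num.sqrt r)%:E =
    (\int[mu]_(t in I) (cst (expR (- (2 + r)))%:E t))%E.
  rewrite integral_cst ?/I /=; last exact: measurable_itv.
  rewrite lebesgue_measure_itv /= lte_fin invr_gt0 s0.
  by rewrite -EFinB subr0 -EFinM.
apply: ge0_le_integral => //.
- exact: measurable_itv.
- by move=> t _; rewrite lee_fin expR_ge0.
- exact: measurable_expRN_cosh.
move=> t; rewrite /I /= in_itv /= => /andP[t0 ts].
rewrite lee_fin ler_expR lerN2.
have t1 : t <= 1 by rewrite (le_trans ts)// invf_le1.
have := @cosh_le _ t; rewrite t0 t1 => /(_ isT) ht.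
apply: (@le_trans _ _ (r * (1 + 2 * t ^+ 2))); first by rewrite ler_wpM2l// ltW.
have rt : r * t ^+ 2 <= 1.
  rewrite -[r in r * _](sqr_sqrtr (ltW r0)) -exprMn expr_le1 ?mulr_ge0 ?sqrtr_ge0 //.
  by rewrite mulrC -ler_pdivlMr ?invr_gt0// ?div1r.
lra.
Qed.

(** The integrand is at least e^{-1} on (0, 1). As [Rintegral] sends an infinite integral to 0,
    finiteness has to be shown as well: e^{-t} <= 1/(1 + t), and t^{-1/2}/(1 + t) has the primitive
    2 arctan(sqrt t), of total variation pi. *)
Lemma Gamma_half_ge : expR (- 1) <= Gamma (1 / 2) :> R.
Proof.
pose g t : R := t `^ (1 / 2 - 1) * expR (- t).
have g0 t : 0 <= g t by rewrite mulr_ge0 ?powR_ge0 ?expR_ge0.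
have mg (D : set R) : measurable_fun D (fun t => (g t)%:E).
  apply: measurable_funTS; apply/measurable_EFinP; apply: measurable_funM.
    exact: measurable_powR.
  by apply: measurableT_comp.
have gE t : 0 < t -> g t = expR (- t) / Num.sqrt t.
  move=> t0; rewrite /g mulrC (_ : 1 / 2 - 1 = - 2^-1); last by field.
  by rewrite powRN powR12_sqrt// ltW.
(* The primitive is not differentiable at 0, so the half-line is exhausted from the right and
   monotone convergence gives the bound pi. *)
pose F (i : nat) : set R := `[i.+1%:R^-1, +oo[%classic.
pose u t : R := 2 * atan (Num.sqrt t).
have du t : 0 < t -> is_derive t 1 u ((Num.sqrt t)^-1 / (1 + t)).
  move=> t0; have ds := is_derive1_sqrt t0.
  rewrite /u; apply: is_derive_eq; rewrite /GRing.scale /=.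
  have s0 : Num.sqrt t != 0 by rewrite lt0r_neq0// sqrtr_gt0.
  have t10 : 1 + t != 0 by rewrite lt0r_neq0// addr_gt0.
  by rewrite (sqr_sqrtr (ltW t0)); field; rewrite t10 s0.
have cu t : 0 < t -> {for t, continuous u}.
  by move=> t0; apply/differentiable_continuous/derivable1_diffP; case: (du _ t0).
have bF i : (\int[mu]_(t in F i) (g t)%:E <= pi%:E)%E.
  have i0 : 0 < i.+1%:R^-1 :> R by rewrite invr_gt0.
  have pos t : i.+1%:R^-1 <= t -> 0 < t by exact: lt_le_trans.
  have cw : {within F i, continuous (fun t => (Num.sqrt t)^-1 / (1 + t))}.
    apply: continuous_in_subspaceT => t; rewrite inE /F /= in_itv /= andbT => /pos t0.
    have s0 : Num.sqrt t != 0 by rewrite lt0r_neq0// sqrtr_gt0.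
    have t10 : 1 + t != 0 by rewrite lt0r_neq0// addr_gt0.
    apply: cvgM; apply: cvgV => //. 
        exact: (@sqrt_continuous R t).
    by apply: cvgD; [exact: cvg_cst|exact: cvg_id].
  have hle : (\int[mu]_(t in F i) ((Num.sqrt t)^-1 / (1 + t))%:E <= pi%:E)%E.
    rewrite (@ge0_continuous_FTC2y _ _ u _ pi).
    - rewrite -EFinB lee_fin lerBlDr lerDl mulr_ge0//.
      by rewrite -atan0 le_atan// sqrtr_ge0.
    - by move=> t /pos t0; rewrite divr_ge0 ?invr_ge0 ?sqrtr_ge0// addr_ge0// ltW.
    - exact: cw.
    - rewrite -[X in _ --> X](@mulfVK _ 2)// mulrC; apply: cvgM; first exact: cvg_cst.
      apply: (cvg_comp Num.sqrt atan); last exact: cvgy_atan.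
      apply/cvgryPge => A; near=> t.
      have At : (Num.max A 0) ^+ 2 <= t by near: t; apply: nbhs_pinfty_ge; exact: num_real.
      have A0 : 0 <= Num.max A 0 by rewrite le_max lexx orbT.
      rewrite (@le_trans _ _ (Num.max A 0))// ?le_max ?lexx//.
      by rewrite -[leLHS](ger0_norm A0) -sqrtr_sqr ler_wsqrtr.
    - by move=> t /ltW /pos t0; case: (du _ t0).
    - apply: cvg_at_right_filter; exact: cu.
    - move=> t; rewrite in_itv /= andbT => /ltW /pos t0.
      by have ? := du _ t0; rewrite derive1E derive_val.
  apply: le_trans hle; apply: ge0_le_integral => //.
  - exact: measurable_itv.
  - by move=> t _; rewrite lee_fin.
  - exact: mg.
  - apply/measurable_EFinP; apply: subspace_continuous_measurable_fun => //.
    exact: measurable_itv.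
  move=> t; rewrite /F /= in_itv /= andbT => /pos t0; rewrite lee_fin gE// mulrC.
  rewrite ler_wpM2l ?invr_ge0 ?sqrtr_ge0// expRN lef_pV2 ?posrE ?expR_gt0//.
    exact: expR_ge1Dx.
  by rewrite addr_gt0.
have FU : `]0, +oo[%classic = \bigcup_i F i.
  apply/seteqP; split => t; rewrite /= in_itv /= andbT.
    move=> t0; have [n nt] := ltr_add_invr t0; exists n => //.
    by rewrite /F /= in_itv /= andbT ltW// -[ltLHS]add0r.
  move=> [i _]; rewrite /F /= in_itv /= andbT; apply: lt_le_trans.
  by rewrite invr_gt0.
have Glty : (\int[mu]_(t in `]0%R, +oo[) (g t)%:E <= pi%:E)%E.
  have cF : (\int[mu]_(t in F i) (g t)%:E @[i --> \oo] -->
     \int[mu]_(t in `]0%R, +oo[) (g t)%:E)%E.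
    rewrite FU; apply: ge0_nondecreasing_set_cvg_integral => //.
    - apply/nondecreasing_seqP => n; rewrite subsetEset /F => t /=.
      rewrite !in_itv /= !andbT; apply: le_trans.
      by rewrite lef_pV2 ?posrE// ler_nat.
    - by move=> i; exact: measurable_itv.
    - by move=> i; exact: mg.
    - by move=> i t _; rewrite lee_fin.
  rewrite -(cvg_lim _ cF)//; apply: lime_le; first by apply/cvg_ex; eexists; exact: cF.
  by apply: nearW => i; exact: bF.
have Gge : ((expR (- 1))%:E <= \int[mu]_(t in `]0%R, +oo[) (g t)%:E)%E.
  apply: (@le_trans _ _ (\int[mu]_(t in `]0%R, 1%R[) (g t)%:E)%E); last first.
    apply: ge0_subset_integral => //; first exact: mg.
    - by move=> t _; rewrite lee_fin.
    by move=> t; rewrite /= !in_itv /= => /andP[-> _].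
  have -> : (expR (- 1))%:E =
      (\int[mu]_(t in `]0%R, 1%R[) (cst (expR (- 1 : R))%:E t))%E.
    by rewrite integral_cst//= lebesgue_measure_itv /= lte01 sube0 mule1.
  apply: ge0_le_integral => //.
  - by move=> t _; rewrite lee_fin expR_ge0.
  - exact: mg.
  move=> t; rewrite /= in_itv /= => /andP[t0 t1]; rewrite lee_fin gE//.
  rewrite ler_pdivlMr ?sqrtr_gt0//.
  apply: (@le_trans _ _ (expR (- 1))); last by rewrite ler_expR lerN2 ltW.
  rewrite -[leRHS]mulr1 ler_wpM2l ?expR_ge0//.
  by rewrite -sqrtr1 ler_wsqrtr// ltW.
rewrite /Gamma /Rintegral -lee_fin fineK; last first.
  rewrite ge0_fin_numE; last by apply: integral_ge0 => t _; rewrite lee_fin; exact: g0.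
  exact: (le_lt_trans Glty (ltry _)).
exact: Gge.
Unshelve. all: by end_near.
Qed.

Lemma Gamma_half_gt0 : 0 < Gamma (1 / 2) :> R.
Proof. by apply: lt_le_trans Gamma_half_ge; exact: expR_gt0. Qed.

End BesselGamma.

(** * The quadratic form of the kernel *)

Section FiniteIntegral.
Context {R : realType}.
Notation mu := (@lebesgue_measure R).

(** Integrability is kept next to the value because [Rintegral] alone has a default value; linear
    combinations then carry both at once. *)
Definition has_integral (D : set R) (F : R -> R) (r : R) :=
  mu.-integrable D (EFin \o F) /\ \int[mu]_(x in D) F x = r.

Lemma has_integral_ereal D F r : measurable D -> has_integral D F r ->
  (\int[mu]_(x in D) (F x)%:E = r%:E)%E.
Proof.
by move=> mD [iF <-]; rewrite /Rintegral fineK//; exact: integrable_fin_num.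
Qed.

Lemma ge0_has_integral (D : set R) (F : R -> R) (r : R) : measurable D ->
  measurable_fun D F -> (forall x, D x -> 0 <= F x) ->
  (\int[mu]_(x in D) (F x)%:E = r%:E)%E -> has_integral D F r.
Proof.
move=> mD mF F0 e; split; last by rewrite /Rintegral e.
apply/integrableP; split; first exact/measurable_EFinP.
suff -> : (\int[mu]_(x in D) `|(EFin \o F) x| = r%:E)%E by rewrite ltry.
rewrite -e; apply: eq_integral => x; rewrite inE => Dx /=.
by rewrite ger0_norm// F0.
Qed.

Lemma has_integralZ (D : set R) (F : R -> R) (r a : R) : measurable D ->
  has_integral D F r -> has_integral D (fun x => a * F x) (a * r).
Proof.
move=> mD [iF <-]; split; last by rewrite RintegralZl.
exact: (@integrableZl _ _ R mu D mD a _ iF).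
Qed.

Lemma has_integralD (D : set R) (F1 F2 : R -> R) (r1 r2 : R) : measurable D ->
  has_integral D F1 r1 -> has_integral D F2 r2 ->
  has_integral D (fun x => F1 x + F2 x) (r1 + r2).
Proof.
move=> mD [i1 e1] [i2 e2]; split; last by rewrite RintegralD// e1 e2.
exact: (@integrableD _ _ R mu D mD _ _ i1 i2).
Qed.

Lemma has_integral_sum (D : set R) (I : finType) (F : I -> R -> R) (r : I -> R) :
  measurable D -> (forall i, has_integral D (F i) (r i)) ->
  has_integral D (fun x => \sum_i F i x) (\sum_i r i).
Proof.
move=> mD h.
have E s : has_integral D (fun x => \sum_(i <- s) F i x) (\sum_(i <- s) r i).
  elim: s => [|i s ih].
    rewrite big_nil; under eq_fun do rewrite big_nil; split.
      exact: integrable0.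
    by rewrite /Rintegral integral0.
  rewrite big_cons; under eq_fun do rewrite big_cons.
  exact: has_integralD.
exact: E.
Qed.

Lemma has_integral_expRN_abs (e : R) : 0 < e ->
  has_integral setT (fun x => expR (- (e * `|x|))) (2 / e).
Proof.
move=> e0; split; first exact: integrable_expRN_abs.
have := Rintegral_expRN_abs_osc 0 1 0 e0.
under eq_Rintegral do rewrite mul0r cos0 mul0r addr0 mulr1 mulr1.
by move=> ->; field; exact: lt0r_neq0.
Qed.

Lemma ge0_integrable_le (F : R -> R) (y : R) : measurable_fun setT F ->
  (forall x, 0 <= F x) -> (\int[mu]_x (F x)%:E <= y%:E)%E ->
  mu.-integrable setT (EFin \o F) /\ \int[mu]_x F x <= y.
Proof.
move=> mF F0 Fy.
have Ffin : (\int[mu]_x (F x)%:E)%E \is a fin_num.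
  rewrite ge0_fin_numE; first exact: le_lt_trans Fy (ltry _).
  by apply: integral_ge0 => x _; rewrite lee_fin.
have [iF eF] := @ge0_has_integral _ F _ measurableT mF (fun x _ => F0 x)
  (esym (fineK Ffin)).
by split => //; rewrite eF -lee_fin fineK.
Qed.

End FiniteIntegral.

Section QuadraticForm.
Context {R : realType}.
Notation mu := (@lebesgue_measure R).
Variables (I : finType) (v p : I -> R).
Implicit Types (a b c t x : R).

(** The squared modulus of the exponential sum \sum_i v_i e^{i p_i x}. *)
Definition trigsum_sq x : R :=
  (\sum_i v i * cos (p i * x)) ^+ 2 + (\sum_i v i * sin (p i * x)) ^+ 2.

(** The squared norm of the functional \sum_i v_i f(p_i) in the dual of the native space of
    [imq c]. *)
Definition imq_form c : R := \sum_i \sum_j v i * v j * imq c (p i - p j).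

Lemma trigsum_sq_ge0 x : 0 <= trigsum_sq x.
Proof. by rewrite addr_ge0// sqr_ge0. Qed.

Lemma trigsum_sqE x :
  trigsum_sq x = \sum_i \sum_j v i * v j * cos ((p i - p j) * x).
Proof.
rewrite /trigsum_sq !expr2 !big_distrlr -big_split; apply: eq_bigr => i _.
rewrite -big_split; apply: eq_bigr => j _ /=.
by rewrite mulrBl cosB; ring.
Qed.

Lemma continuous_trigsum_sq : continuous trigsum_sq.
Proof.
rewrite (_ : trigsum_sq = fun x => \sum_i \sum_j v i * v j * cos ((p i - p j) * x)).
  have csum (F : I -> R -> R) : (forall i, continuous (F i)) ->
      continuous (fun x => \sum_i F i x).
    by move=> cF; apply: continuous_big => //; exact: add_continuous.
  apply: (csum) => i; apply: (csum) => j.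
  by apply: derivable_cts => z; apply: ex_derive.
by apply/funext => x; exact: trigsum_sqE.
Qed.

Lemma has_integral_trigsum_sq a : 0 < a ->
  has_integral setT (fun x => expR (- (a * `|x|)) * trigsum_sq x)
    (2 * \sum_i \sum_j v i * v j * (a / (a ^+ 2 + (p i - p j) ^+ 2))).
Proof.
move=> a0.
rewrite (_ : (fun _ => _) = fun x => \sum_i \sum_j (v i * v j *
   (expR (- (a * `|x|)) * (1 * cos ((p i - p j) * x) + 0 * sin ((p i - p j) * x))))).
  rewrite mulr_sumr; apply: has_integral_sum => // i.
  rewrite mulr_sumr; apply: has_integral_sum => // j.
  rewrite mulrCA; apply: has_integralZ => //; split.
    exact: integrable_expRN_abs_osc.
  by rewrite Rintegral_expRN_abs_osc// mulr1 mulrA.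
apply/funext => x; rewrite trigsum_sqE mulr_sumr; apply: eq_bigr => i _.
rewrite mulr_sumr; apply: eq_bigr => j _; ring.
Qed.

Lemma imqE c x : imq c x = Gamma (1 / 2) / Num.sqrt (c ^+ 2 + x ^+ 2).
Proof.
by rewrite /imq powRN div1r powR12_sqrt// addr_ge0 ?sqr_ge0.
Qed.

Lemma has_integral_cosh c x : 0 < c ->
  has_integral `[0, +oo[ (fun t => c * cosh t / ((c * cosh t) ^+ 2 + x ^+ 2))
    (pi / 2 / Num.sqrt (c ^+ 2 + x ^+ 2)).
Proof.
move=> c0.
have D0 t : 0 < (c * cosh t) ^+ 2 + x ^+ 2.
  by rewrite ltr_wpDr ?sqr_ge0// exprn_gt0// mulr_gt0// cosh_gt0.
apply: ge0_has_integral; last exact: integral_cosh.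
- exact: measurable_itv.
- apply: measurable_funTS; apply: continuous_measurable_fun => t.
  apply: cvgM; first by apply: cvgM; [exact: cvg_cst|exact: continuous_cosh].
  apply: cvgV; first exact: lt0r_neq0.
  apply: (@derivable_cts _ (fun t => (c * cosh t) ^+ 2 + x ^+ 2)) => z.
  by rewrite /cosh; apply: ex_derive.
- by move=> t _; rewrite divr_ge0 ?(ltW (D0 _))// mulr_ge0 ?(ltW c0)// ltW// cosh_gt0.
Qed.

Lemma has_integral_imq_form c : 0 < c ->
  has_integral `[0, +oo[ (fun t =>
      \int[mu]_x (expR (- (c * cosh t * `|x|)) * trigsum_sq x))
    (pi / Gamma (1 / 2) * imq_form c).
Proof.
move=> c0.
have G0 := lt0r_neq0 (@Gamma_half_gt0 R).
rewrite (_ : (fun _ => _) = fun t => \sum_i \sum_j (2 * v i * v j *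
   (c * cosh t / ((c * cosh t) ^+ 2 + (p i - p j) ^+ 2)))).
  rewrite mulr_sumr; apply: has_integral_sum => // i.
  rewrite mulr_sumr; apply: has_integral_sum => // j.
  rewrite (_ : pi / _ * _ = 2 * v i * v j *
      (pi / 2 / Num.sqrt (c ^+ 2 + (p i - p j) ^+ 2))).
    by apply: has_integralZ => //; exact: has_integral_cosh.
  by rewrite imqE; set s := (Num.sqrt _)^-1; field.
apply/funext => t.
have ct0 : 0 < c * cosh t by rewrite mulr_gt0// cosh_gt0.
have [_ ->] := has_integral_trigsum_sq ct0.
rewrite mulr_sumr; apply: eq_bigr => i _; rewrite mulr_sumr; apply: eq_bigr => j _.
by rewrite !mulrA.
Qed.

(** Tonelli for e^{-c cosh(t)|x|} * [trigsum_sq x] on t >= 0: integrating in t first gives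
    K_0(c|x|), integrating in x first gives [has_integral_imq_form]. Measurability of the K_0
    integrand is obtained from the same theorem, as that of a partial integral. *)
Lemma integral_trigsum_sq_besselK0 c : 0 < c ->
  measurable_fun setT (fun x => (trigsum_sq x)%:E * besselK0 (c * `|x|))%E /\
  (\int[mu]_x ((trigsum_sq x)%:E * besselK0 (c * `|x|)) =
   (pi / Gamma (1 / 2) * imq_form c)%:E)%E.
Proof.
move=> c0; pose D : set R := `[0, +oo[%classic.
pose g t x : R := expR (- (c * cosh t * `|x|)) * trigsum_sq x.
pose F (z : R * R) : \bar R := (\1_D z.1 * g z.1 z.2)%:E.
have mD : measurable D by exact: measurable_itv.
have g0 t x : 0 <= g t x by rewrite mulr_ge0 ?expR_ge0 ?trigsum_sq_ge0.
have mF : measurable_fun setT F.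
  apply/measurable_EFinP; apply: measurable_funM.
    by apply: measurableT_comp => //; exact: measurable_indic.
  apply: measurable_funM.
    apply: measurableT_comp => //; apply: measurableT_comp => //.
    apply: measurable_funM; last exact: measurableT_comp.
    apply: measurable_funM => //; apply: (@measurableT_comp _ _ _ _ _ _ cosh) => //.
    by apply: continuous_measurable_fun; exact: continuous_cosh.
  apply: (@measurableT_comp _ _ _ _ _ _ trigsum_sq) => //.
  by apply: continuous_measurable_fun; exact: continuous_trigsum_sq.
have F0 z : (0 <= F z)%E by rewrite lee_fin mulr_ge0.
have /= FT := @fubini_tonelli _ _ _ _ R mu mu F mF F0.
have FK x : ((trigsum_sq x)%:E * besselK0 (c * `|x|) = \int[mu]_t F (t, x))%E.
  transitivity (\int[mu]_(t in D) (g t x)%:E)%E; last first.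
    rewrite integral_mkcond; apply: eq_integral => t _; rewrite patchE /F /= indicE.
    by case: ifPn => tD; rewrite ?tD ?(negbTE tD) ?mul1r ?mul0r.
  transitivity (\int[mu]_(t in D)
      ((expR (- (c * `|x| * cosh t)))%:E * (trigsum_sq x)%:E))%E.
    rewrite muleC ge0_integralZr ?lee_fin ?trigsum_sq_ge0//.
    exact: measurable_expRN_cosh.
  by apply: eq_integral => t _; rewrite -EFinM /g mulrAC.
under eq_fun do rewrite FK; split.
  exact: (@measurable_fun_fubini_tonelli_G _ _ _ _ _ mu F mF F0).
rewrite -FT -(has_integral_ereal mD (has_integral_imq_form c0)).
rewrite [RHS]integral_mkcond; apply: eq_integral => t _.
rewrite patchE; case: ifPn => tD.
  have ct0 : 0 < c * cosh t := mulr_gt0 c0 (cosh_gt0 t).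
  have hi := has_integral_trigsum_sq ct0; have [_ ->] := hi.
  rewrite -(has_integral_ereal measurableT hi); apply: eq_integral => x _.
  by rewrite /F /= indicE tD mul1r.
rewrite -[RHS](integral0 mu setT); apply: eq_integral => x _.
by rewrite /F /= indicE (negbTE tD) mul0r.
Qed.

End QuadraticForm.

(** * An explicit weight below K_0, and bounds for the form *)

Section BesselWeight.
Context {R : realType}.
Notation mu := (@lebesgue_measure R).
Implicit Types (c x : R).

(* Its reciprocal minorizes K_0(c|x|), and up to the factor e^2 it is the
   weight of the terms A and B. *)
Definition bessel_weight c x : R :=
  if c * `|x| <= 1 then (besselK 0 1)^-1
  else Num.sqrt (c * `|x|) * expR (2 + c * `|x|).

Lemma besselK01_fin : (besselK 0 1)%:E = besselK0 1 :> \bar R.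
Proof.
rewrite besselKE fineK// ge0_fin_numE; last exact: besselK0_ge0.
exact: besselK0_lty.
Qed.

Lemma besselK01_gt0 : 0 < besselK 0 1 :> R.
Proof.
rewrite -lte_fin besselK01_fin; apply: lt_le_trans (besselK0_lower_bound (lexx 1)).
by rewrite lte_fin divr_gt0 ?expR_gt0// sqrtr_gt0.
Qed.

Lemma bessel_weight_gt0 c x : 0 < bessel_weight c x.
Proof.
rewrite /bessel_weight; case: ifPn => [_|]; first by rewrite invr_gt0 besselK01_gt0.
by rewrite -ltNge => cx; rewrite mulr_gt0 ?expR_gt0// sqrtr_gt0 (lt_trans ltr01).
Qed.

Lemma bessel_weightV_le c x :
  ((bessel_weight c x)^-1%:E <= besselK0 (c * `|x|))%E.
Proof.
rewrite /bessel_weight; case: ifPn => [cx|].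
  by rewrite invrK besselK01_fin le_besselK0.
rewrite -ltNge => cx; rewrite invfM mulrC -expRN.
by apply: besselK0_lower_bound; exact: ltW.
Qed.

Lemma measurable_bessel_weight (D : set R) c :
  measurable_fun D (bessel_weight c).
Proof.
apply: measurable_funTS.
have mcx : measurable_fun setT (fun x : R => c * `|x|).
  exact: measurable_funM.
apply: measurable_fun_ifT => //=; first exact: measurable_fun_ler.
apply: measurable_funM.
  apply: measurableT_comp mcx; apply: continuous_measurable_fun.
  exact: sqrt_continuous.
by apply: measurableT_comp => //; exact: measurable_funD.
Qed.

Lemma measurable_bessel_weightV (D : set R) c :
  measurable_fun D (fun x => (bessel_weight c x)^-1).
Proof.
rewrite (_ : (fun x => _) = fun x => bessel_weight c x `^ (- 1)); last first.
  by apply/funext => x; rewrite powR_inv1// ltW// bessel_weight_gt0.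
apply: measurable_funTS.
apply: (@measurableT_comp _ _ _ _ _ _ (fun y : R => y `^ (- 1))).
  exact: measurable_powR.
exact: measurable_bessel_weight.
Qed.

End BesselWeight.

Section QuadraticFormBounds.
Context {R : realType}.
Notation mu := (@lebesgue_measure R).
Variables (I : finType) (v p : I -> R).
Implicit Types (c x : R).

Lemma integral_trigsum_sq_weight_le c : 0 < c ->
  (\int[mu]_x (trigsum_sq v p x / bessel_weight c x)%:E <=
   (pi / Gamma (1 / 2) * imq_form v p c)%:E)%E.
Proof.
move=> c0; have [mK <-] := integral_trigsum_sq_besselK0 v p c0.
apply: ge0_le_integral => //.
- by move=> x _; rewrite lee_fin divr_ge0 ?trigsum_sq_ge0// ltW// bessel_weight_gt0.
- apply/measurable_EFinP; apply: measurable_funM.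
    by apply: continuous_measurable_fun; exact: continuous_trigsum_sq.
  exact: measurable_bessel_weightV.
- by move=> x _; rewrite EFinM lee_wpmul2l ?lee_fin ?trigsum_sq_ge0// bessel_weightV_le.
Qed.

(** Half of the exponential absorbs the power: y^n / n! <= e^y at y = a|x|/2. *)
Lemma expRN_abs_exprn_le (a x : R) n : 0 < a ->
  expR (- (a * `|x|)) * `|x| ^+ n <= n`!%:R * (2 / a) ^+ n * expR (- (a / 2 * `|x|)).
Proof.
move=> a0; pose y := a / 2 * `|x|.
have y0 : 0 <= y by rewrite mulr_ge0// divr_ge0// ltW.
have a00 : a != 0 by exact: lt0r_neq0.
have -> : - (a * `|x|) = - y - y by rewrite /y; field.
have -> : `|x| = 2 / a * y by rewrite /y; field.
have f0 : 0 < n`!%:R :> R by rewrite ltr0n fact_gt0.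
have yn : y ^+ n <= n`!%:R * expR y.
  rewrite mulrC -ler_pdivrMr//; case: n {f0} => [|n].
    by rewrite expr0 fact0 divr1 -expR0 ler_expR.
  by apply: le_trans (expR_ge1Dxn n y0); rewrite lerDr.
rewrite exprMn expRD -mulrA.
rewrite (_ : n`!%:R * _ * _ = expR (- y) * ((2 / a) ^+ n * n`!%:R)); last first.
  by rewrite mulrC [n`!%:R * _]mulrC (_ : a / 2 * _ = y)// /y; field.
rewrite ler_wpM2l ?expR_ge0// mulrCA ler_wpM2l ?exprn_ge0 ?divr_ge0 ?(ltW a0)//.
by rewrite -ler_pdivlMl ?expR_gt0// -expRN opprK mulrC.
Qed.

(** For e = c cosh t the inner integral is at most B n! (2/e)^n (4/e). Only the power is weakened to
    (2/c)^n; the factor 1/e is kept, since it makes the integral over t converge, to pi/(2c). *)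
Lemma imq_form_le c (B : R) n : 0 < c -> 0 <= B ->
  (forall x, trigsum_sq v p x <= B * `|x| ^+ n) ->
  imq_form v p c <= 2 * Gamma (1 / 2) * B * n`!%:R * (2 / c) ^+ n / c.
Proof.
move=> c0 B0 VB.
have G0 := @Gamma_half_gt0 R.
pose K := 4 * B * n`!%:R * (2 / c) ^+ n.
have K0 : 0 <= K by rewrite !mulr_ge0 ?exprn_ge0// divr_ge0// ltW.
have [iQ eQ] := has_integral_imq_form v p c0.
have [iC eC] := has_integral_cosh 0 c0.
have : pi / Gamma (1 / 2) * imq_form v p c <= K * (pi / 2 / c).
  rewrite -eQ (_ : pi / 2 / c = pi / 2 / Num.sqrt (c ^+ 2 + 0 ^+ 2)); last first.
    by rewrite expr0n addr0 sqrtr_sqr gtr0_norm.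
  rewrite -eC -RintegralZl//.
  apply: le_Rintegral => //.
    exact: (@integrableZl _ _ R mu _ (measurable_itv _) K _ iC).
  move=> t _; set e := c * cosh t.
  have e0 : 0 < e by rewrite mulr_gt0// cosh_gt0.
  have e20 : 0 < e / 2 by rewrite divr_gt0.
  have ce : c <= e by rewrite -[leLHS]mulr1 ler_wpM2l ?(ltW c0)// cosh_ge1.
  have [iV eV] := has_integral_trigsum_sq v p e0.
  have [iE eE0] := has_integral_expRN_abs e20.
  have eE : \int[mu]_x expR (- (e / 2 * `|x|)) = 4 / e.
    by rewrite eE0; field; exact: lt0r_neq0.
  apply: (@le_trans _ _ (B * n`!%:R * (2 / e) ^+ n * (4 / e))).
    rewrite -eE -RintegralZl//; apply: le_Rintegral => //.
      exact: (@integrableZl _ _ R mu _ measurableT _ _ iE).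
    move=> x _; apply: (@le_trans _ _ (expR (- (e * `|x|)) * (B * `|x| ^+ n))).
      by rewrite ler_wpM2l ?expR_ge0.
    rewrite mulrCA [leRHS](_ : _ =
      B * (n`!%:R * (2 / e) ^+ n * expR (- (e / 2 * `|x|)))); last by rewrite !mulrA.
    by rewrite ler_wpM2l// expRN_abs_exprn_le.
  have -> : e / (e ^+ 2 + 0 ^+ 2) = e^-1.
    by rewrite expr0n addr0 expr2 invfM mulrA mulfV ?mul1r// lt0r_neq0.
  rewrite mulrA ler_wpM2r ?invr_ge0 ?(ltW e0)// /K.
  rewrite (_ : 4 * B * _ * _ = B * n`!%:R * (2 / c) ^+ n * 4); last by ring.
  rewrite ler_wpM2r// ler_wpM2l ?mulr_ge0//.
  rewrite lerXn2r ?nnegrE ?divr_ge0 ?(ltW c0) ?(ltW e0)//.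
  by rewrite ler_wpM2l// lef_pV2.
rewrite -ler_pdivlMl ?divr_gt0 ?pi_gt0// => /le_trans; apply.
rewrite le_eqVlt; apply/orP; left; apply/eqP; rewrite /K.
have := lt0r_neq0 (pi_gt0 R); move: (pi : R) => P P0; field.
by rewrite (lt0r_neq0 G0) (lt0r_neq0 c0) P0.
Qed.

End QuadraticFormBounds.

(** * Lagrange interpolation of exponentials *)

Section InterpolationError.
Context {R : realType}.
Implicit Types (x y t : R) (s : seq R).

Lemma Rolle_sorted (F F' : R -> R) x s :
  (forall y, is_derive y 1 F (F' y)) -> path <%R x s ->
  all (fun y => F y == 0) (x :: s) ->
  exists s', [/\ size s' = size s, path <%R x s' & all (fun y => F' y == 0) s'].
Proof.
move=> dF; elim: s x => [|y s ih] x /=; first by exists [::].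
move=> /andP[xy ys] /and3P[/eqP Fx /eqP Fy Fs].
have [s' [ss ys' F's]] : exists s', [/\ size s' = size s, path <%R y s' &
    all (fun y => F' y == 0) s'] by apply: ih => //=; rewrite Fy eqxx.
have dvF z : derivable F z 1 by case: (dF z).
have cF : {within `[x, y], continuous F} by apply: derivable_within_continuous.
have [c] := Rolle xy (fun z _ => dvF z) cF (etrans Fx (esym Fy)).
rewrite in_itv /= => /andP[xc cy] dc; exists (c :: s'); split => /=.
- by rewrite ss.
- by rewrite xc /=; exact: (path_le lt_trans cy ys').
- rewrite F's andbT; apply/eqP.
  by have /@derive_val <- := dF c; have /@derive_val -> := dc.
Qed.

Lemma Rolle_iter (F : nat -> R -> R) x s :
  (forall n y, is_derive y 1 (F n) (F n.+1 y)) -> path <%R x s ->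
  all (fun y => F 0%N y == 0) (x :: s) -> exists c, F (size s) c = 0.
Proof.
move sn : (size s) => n; elim: n F x s sn => [|n ih] F x s sn dF xs.
  by move=> /andP[/eqP F0 _]; exists x.
move=> /(Rolle_sorted (dF 0%N) xs)[s' []]; rewrite sn; case: s' => [//|c s'].
move=> [sn'] /= /andP[_ cs'] F1.
by have [d Fd] := ih (fun n => F n.+1) c s' sn' (fun n => dF n.+1) cs' F1; exists d.
Qed.

Definition lagrange_weight k (z : 'I_k -> R) t i : R :=
  \prod_(j | j != i) ((t - z j) / (z i - z j)).

Definition lagrange_poly k (z : 'I_k -> R) i : {poly R} :=
  \prod_(j | j != i) ((z i - z j)^-1 *: ('X - (z j)%:P)).

Lemma horner_lagrange_poly k (z : 'I_k -> R) i t :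
  (lagrange_poly z i).[t] = lagrange_weight z t i.
Proof.
rewrite horner_prod; apply: eq_bigr => j _.
by rewrite hornerZ hornerXsubC mulrC.
Qed.

Lemma size_lagrange_poly k (z : 'I_k -> R) i : (size (lagrange_poly z i) <= k)%N.
Proof.
have cardP : #|[pred j | j != i]| = k.-1 by rewrite cardC1 card_ord.
apply: leq_trans (size_poly_prod_leq _ _) _; rewrite cardP.
apply: (@leq_trans ((\sum_(j < k | j != i) 2).+1 - k.-1)).
  rewrite leq_sub2r// ltnS leq_sum// => j _.
  by apply: leq_trans (size_scale_leq _ _) _; rewrite size_XsubC.
rewrite sum_nat_const cardP; case: k i {z cardP} => [[]//|k _] /=; lia.
Qed.

Lemma lagrange_weight_node k (z : 'I_k -> R) i m : injective z ->
  lagrange_weight z (z m) i = (m == i)%:R.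
Proof.
move=> zI; rewrite /lagrange_weight; case: eqVneq => [->|mi].
  rewrite big1// => j ji; rewrite divff// subr_eq0.
  by apply: contra ji => /eqP /zI ->.
by rewrite (bigD1 m)//= subrr !mul0r.
Qed.

(** The classical remainder argument: a multiple of the nodal polynomial w is added to the
    interpolant P so that the difference also vanishes at t, and Rolle's theorem is applied k times
    to its k + 1 zeros. The phase [phi] covers sine and cosine together. *)
Lemma cos_interpolation_error k (z : 'I_k -> R) t (D xi phi : R) :
  injective z -> (forall i, `|t - z i| <= D) ->
  `|cos (t * xi + phi) - \sum_i lagrange_weight z t i * cos (z i * xi + phi)| <=
   (D * `|xi|) ^+ k / k`!%:R.
Proof.
move=> zI zD.
have k0 : 0 < k`!%:R :> R by rewrite ltr0n fact_gt0.
(* If t is a node, w(t) = 0 and the quotient [K] below is meaningless, but then the error is 0. *)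
have [[i ti]|tz] := pselect (exists i, t = z i).
  rewrite (bigD1 i)//= ti lagrange_weight_node// eqxx mul1r big1.
    rewrite addr0 subrr normr0 divr_ge0 ?(ltW k0)// exprn_ge0// mulr_ge0//.
    exact: le_trans (zD i).
  by move=> j ji; rewrite lagrange_weight_node// eq_sym (negbTE ji) mul0r.
pose g y : R := cos (y * xi + phi).
pose P : {poly R} := \sum_i g (z i) *: lagrange_poly z i.
pose w : {poly R} := \prod_i ('X - (z i)%:P).
have Pz i : P.[z i] = g (z i).
  rewrite horner_sum (bigD1 i)//= hornerZ horner_lagrange_poly.
  rewrite lagrange_weight_node// eqxx mulr1 big1 ?addr0// => j ji.
  by rewrite hornerZ horner_lagrange_poly lagrange_weight_node// eq_sym (negbTE ji) mulr0.
have Pt : P.[t] = \sum_i lagrange_weight z t i * g (z i).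
  by rewrite horner_sum; apply: eq_bigr => i _; rewrite hornerZ horner_lagrange_poly mulrC.
have wE y : w.[y] = \prod_i (y - z i).
  by rewrite horner_prod; apply: eq_bigr => i _; rewrite hornerXsubC.
have wt0 : w.[t] != 0.
  rewrite wE; apply/prodf_neq0 => i _; rewrite subr_eq0; apply/eqP => e.
  by apply: tz; exists i.
pose K := (g t - P.[t]) / w.[t].
pose q := P + K *: w.
have sw : size w = k.+1 by rewrite /w -big_enum size_prod_XsubC size_enum_ord.
have qk : q^`(k) = (K * k`!%:R)%:P.
  have sP : (size P <= k)%N.
    apply: leq_trans (size_sum _ _ _) _; apply/bigmax_leqP => i _.
    by apply: leq_trans (size_scale_leq _ _) (size_lagrange_poly _ _).
  have wk : w`_k = 1.
    have /monicP : w \is monic by exact: monic_prod_XsubC.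
    by rewrite lead_coefE sw.
  apply/polyP => i; rewrite coef_derivn coefC coefD coefZ.
  rewrite nth_default; last exact: leq_trans sP (leq_addr _ _).
  rewrite add0r; case: i => [|i] /=; first by rewrite addn0 wk mulr1 ffactnn mulr_natr.
  by rewrite [w`_ _]nth_default ?mulr0 ?mul0rn// sw addnS ltnS leq_addr.
(* The n-th derivative of the error in closed form: each differentiation of the cosine adds pi/2 to
   the phase. *)
pose F n y : R := xi ^+ n * cos (y * xi + phi + pi / 2 *+ n) - q^`(n).[y].
have dF n y : is_derive y 1 (F n) (F n.+1 y).
  have d0 : is_derive y 1 (fun y => cos (y * xi + phi + pi / 2 *+ n))
      (xi * cos (y * xi + phi + pi / 2 *+ n.+1)).
    rewrite [pi / 2 *+ n.+1]mulrSr addrA cosDpihalf.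
    by apply: is_derive_eq; rewrite /GRing.scale /=; ring.
  have d1 : is_derive y 1 (fun y => q^`(n).[y]) q^`(n.+1).[y].
    by rewrite derivnS; exact: is_derive_poly.
  by apply: is_derive_eq; rewrite /GRing.scale /= /F exprSr; ring.
have F0 y : F 0%N y = g y - q.[y].
  by rewrite /F expr0 mul1r mulr0n addr0 derivn0.
pose s := sort <=%R (t :: codom z).
have us : uniq (t :: codom z).
  rewrite /= map_inj_uniq ?enum_uniq// andbT; apply/negP => /codomP[i ti].
  by apply: tz; exists i.
have lts : sorted <%R s.
  by rewrite lt_sorted_uniq_le sort_uniq us sort_le_sorted.
have Fs : all (fun y => F 0%N y == 0) s.
  apply/allP => y; rewrite mem_sort inE => /orP[/eqP ->|/codomP[i ->]].
    by rewrite F0 hornerD hornerZ mulfVK// addrCA subrr addr0 subrr.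
  rewrite F0 hornerD hornerZ Pz (_ : w.[z i] = 0) ?mulr0 ?addr0 ?subrr//.
  by rewrite wE (bigD1 i)//= subrr mul0r.
have ss : size s = k.+1 by rewrite size_sort /= size_codom card_ord.
move: lts Fs ss; case: s => [//|x s] lts Fs [ss].
have [c] := Rolle_iter dF lts Fs.
rewrite ss /F qk hornerC => /eqP; rewrite subr_eq0 => /eqP Kc.
have {}Kc : `|K| <= `|xi| ^+ k / k`!%:R.
  rewrite ler_pdivlMr// -[X in _ * X]ger0_norm ?(ltW k0)// -normrM -Kc normrM normrX.
  rewrite -[leRHS]mulr1 ler_wpM2l ?exprn_ge0//.
  by rewrite ler_norml cos_geN1 cos_le1.
rewrite -/(g t) -Pt -[g t - _](mulfVK wt0) -/K normrM.
apply: (@le_trans _ _ (`|xi| ^+ k / k`!%:R * D ^+ k)); last first.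
  by rewrite exprMn mulrAC [`|xi| ^+ k * _]mulrC.
apply: ler_pM => //; rewrite wE normr_prod.
apply: (@le_trans _ _ (\prod_(i < k) D)); last by rewrite prodr_const card_ord.
by apply: ler_prod => i _; rewrite normr_ge0 zD.
Qed.

End InterpolationError.

(** * Point functionals on band-limited functions *)

Section PoissonKernel.
Context {R : realType}.
Notation mu := (@lebesgue_measure R).
Implicit Types (a p x r e T : R).

Definition poisson a p x : R := a / (a ^+ 2 + (x - p) ^+ 2).

Lemma poisson_den_gt0 a p x : 0 < a -> 0 < a ^+ 2 + (x - p) ^+ 2.
Proof. by move=> a0; rewrite ltr_wpDr ?sqr_ge0// exprn_gt0. Qed.

Lemma poisson_ge0 a p x : 0 < a -> 0 <= poisson a p x.
Proof. by move=> a0; rewrite divr_ge0 ?(ltW a0)// ltW// poisson_den_gt0. Qed.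

Lemma continuous_poisson a p : 0 < a -> continuous (poisson a p).
Proof.
move=> a0; apply: derivable_cts => x.
have ? := lt0r_neq0 (poisson_den_gt0 p x a0).
by apply: derivableM => //; apply: derivableV.
Qed.

Lemma has_integral_poisson a p : 0 < a -> has_integral setT (poisson a p) pi.
Proof.
move=> a0; apply: ge0_has_integral => //; last exact: integral_atan.
- by apply: continuous_measurable_fun; exact: continuous_poisson.
- by move=> x _; exact: poisson_ge0.
Qed.

(* The majorant of the integrand away from p: it is integrable, and it does
   not involve the scale e of the kernel except through the factor e. *)
Lemma poisson_tail_le (y yp r e p x : R) : 0 < r -> 0 < e -> r <= `|x - p| ->
  (`|y| + `|yp|) * poisson e p x <=
  e * (y ^+ 2 + (r^-1 ^+ 2 + `|yp|) * (1 + r^-1 ^+ 2) * poisson 1 p x).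
Proof.
move=> r0 e0 rx; rewrite /poisson; set u := x - p.
set W := u ^+ 2; set s := r^-1 ^+ 2; set q := 1 / (1 ^+ 2 + W).
have rW : r ^+ 2 <= W by rewrite /W -(real_normK (num_real u)) lerXn2r ?nnegrE// ltW.
have W0 : 0 < W by apply: lt_le_trans rW; rewrite exprn_gt0.
have s0 : 0 <= s by exact: sqr_ge0.
have Ws : 1 <= W * s.
  rewrite /s exprVn -[leLHS](@mulfV _ (r ^+ 2)) ?lt0r_neq0 ?exprn_gt0//.
  by rewrite ler_wpM2r// invr_ge0 exprn_ge0// ltW.
have Z0 : 0 < W^-1 by rewrite invr_gt0.
have Zs : W^-1 <= s by rewrite -[leLHS]mulr1 ler_pdivrMl.
have Zq : W^-1 <= (1 + s) * q.
  rewrite /q expr1n div1r ler_pdivlMr ?addr_gt0// mulrC ler_pdivrMr//.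
  by rewrite mulrDl mul1r addrC lerD2l mulrC.
have q0 : 0 <= q by rewrite /q divr_ge0// addr_ge0 ?sqr_ge0.
rewrite mulrCA ler_wpM2l ?(ltW e0)//.
apply: (@le_trans _ _ ((`|y| + `|yp|) * W^-1)).
  by rewrite ler_wpM2l// lef_pV2 ?posrE// ?lerDr ?sqr_ge0// ltr_wpDl ?sqr_ge0.
(* The product is split by 2ab <= a^2 + b^2, because in the application y is a value of a function
   known only to be square integrable. *)
have yZ : `|y| * W^-1 <= y ^+ 2 + s * ((1 + s) * q).
  have := sqr_ge0 (`|y| - W^-1); rewrite -(real_normK (num_real y)).
  have := ler_pM (ltW Z0) (ltW Z0) Zs Zq; have := normr_ge0 y.
  have := mulr_ge0 (normr_ge0 y) (ltW Z0).
  by rewrite sqrrB; nra.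
have ypZ : `|yp| * W^-1 <= `|yp| * ((1 + s) * q) by rewrite ler_wpM2l.
by rewrite mulrDl; nra.
Qed.

(** Near p, continuity gives an error of d/(2 pi) per unit of kernel mass, and the mass is pi; away
    from p, [poisson_tail_le] gives at most e (N + C pi). Each part receives d/2. The majorant does
    not depend on T, so e can be chosen first. *)
Lemma poisson_approximation (phi : R -> R) p (d : R) :
  continuous phi -> mu.-integrable setT (EFin \o (fun x => phi x ^+ 2)) -> 0 < d ->
  \forall e \near 0^'+, \forall T \near +oo,
    `|\int[mu]_(x in `[- T, T]) (phi x * poisson e p x) - pi * phi p| <= d.
Proof.
move=> cphi i2 d0; have pi0 := pi_gt0 R.
have d20 : 0 < d / (2 * pi) by rewrite divr_gt0// mulr_gt0.
have /cvgrPdist_le/(_ _ d20)/nbhs_ballP[r /= r0 hr] := cphi p.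
pose C := (r^-1 ^+ 2 + `|phi p|) * (1 + r^-1 ^+ 2).
have C0 : 0 <= C by rewrite mulr_ge0// addr_ge0// sqr_ge0.
pose N := \int[mu]_x (phi x ^+ 2).
have N0 : 0 <= N by apply: Rintegral_ge0 => x _; exact: sqr_ge0.
have NC : 0 < N + C * pi + 1 by rewrite ltr_wpDl// addr_ge0// mulr_ge0// ltW.
near=> e; have e0 : 0 < e by near: e; exact: nbhs_right_gt.
have eN : e * (N + C * pi) <= d / 2.
  apply: (@le_trans _ _ (e * (N + C * pi + 1))).
    by rewrite ler_wpM2l ?(ltW e0)// lerDl.
  rewrite -ler_pdivlMr//; near: e; apply: nbhs_right_le.
  by rewrite !divr_gt0.
near=> T.
(* The window then contains the ball of radius r around p: the truncation acts only in the tail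
   region, where the majorant holds on and off [D]. *)
have pT : `|p| + r <= T by near: T; apply: nbhs_pinfty_ge; exact: num_real.
pose D : set R := `[- T, T]%classic.
have mD : measurable D by exact: measurable_itv.
have [iP eP] := has_integral_poisson p e0.
have [iP1 eP1] := has_integral_poisson p (@ltr01 R).
pose F := (fun x => phi x * poisson e p x) \_ D.
pose M x := d / (2 * pi) * poisson e p x + e * (phi x ^+ 2 + C * poisson 1 p x).
have P0 x : 0 <= poisson e p x by exact: poisson_ge0.
have P10 x : 0 <= poisson 1 p x by exact: poisson_ge0.
have FM x : `|F x - phi p * poisson e p x| <= M x.
  have t0 : 0 <= e * (phi x ^+ 2 + C * poisson 1 p x).
    by rewrite mulr_ge0 ?(ltW e0)// addr_ge0 ?sqr_ge0// mulr_ge0.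
  have [xr|rx] := ltP `|x - p| r.
    have -> : F x = phi x * poisson e p x.
      rewrite /F patchE mem_set// /D /= in_itv /= -ler_norml.
      rewrite -(subrK p x) (le_trans (ler_normD _ _))// addrC (le_trans _ pT)//.
      by rewrite lerD2l ltW.
    rewrite -mulrBl normrM (ger0_norm (P0 x)) /M ler_wpDr// ler_wpM2r//.
    by rewrite distrC; apply: hr; rewrite /ball /= distrC.
  rewrite /M ler_wpDl//; first by rewrite mulr_ge0// ltW.
  apply: le_trans (poisson_tail_le (phi x) (phi p) r0 e0 rx).
  rewrite (le_trans (ler_normB _ _))// mulrDl normrM (ger0_norm (P0 x)) lerD2r.
  rewrite /F patchE; case: ifPn => _; first by rewrite normrM (ger0_norm (P0 x)).
  by rewrite normr0 mulr_ge0.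
have hM : has_integral setT M (d / (2 * pi) * pi + e * (N + C * pi)).
  apply: has_integralD => //; first exact: has_integralZ.
  apply: has_integralZ => //; apply: has_integralD => //.
  by apply: has_integralZ => //; exact: has_integral_poisson.
have mphi : measurable_fun setT phi by exact: continuous_measurable_fun.
have mP : measurable_fun setT (poisson e p).
  by apply: continuous_measurable_fun; exact: continuous_poisson.
have mF : measurable_fun setT F.
  have mDF : measurable_fun D (fun x => phi x * poisson e p x).
    by apply: measurable_funTS; exact: measurable_funM.
  exact: (@measurable_restrictT _ _ _ _ D _ mD).1 mDF.
have iphiP := @integrableZl _ _ R mu _ measurableT (phi p) _ iP.
have iFp : mu.-integrable setT (EFin \o (fun x => F x - phi p * poisson e p x)).
  apply: le_integrable hM.1 => //.
    apply/measurable_EFinP; apply: measurable_funB => //.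
    exact: measurable_funM.
  move=> x _; rewrite /= lee_fin (le_trans (FM x))//; exact: ler_norm.
have iF : mu.-integrable setT (EFin \o F).
  have := @integrableD _ _ R mu _ measurableT _ _ iFp iphiP.
  by apply: eq_integrable => // x _ /=; rewrite -EFinM -EFinD subrK.
rewrite (_ : _ - _ = \int[mu]_x (F x - phi p * poisson e p x)); last first.
  by rewrite RintegralB// RintegralZl// eP mulrC [in LHS]Rintegral_mkcond.
apply: le_trans (le_normr_Rintegral _ iFp) _ => //.
have [iM eM] := hM.
apply: (@le_trans _ _ (\int[mu]_x M x)).
  apply: le_Rintegral => //.
  exact: (integrable_norm iFp).
rewrite eM invfM mulrCA mulrA mulfVK ?lt0r_neq0//; lra.
Unshelve. all: by end_near.
Qed.

End PoissonKernel.

Section Fubini.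
Context {R : realType}.
Notation mu := (@lebesgue_measure R).
Variables (A B : R -> R) (T p e : R).
Hypotheses (cA : continuous A) (cB : continuous B) (e0 : 0 < e).

Let D : set R := `[- T, T]%classic.
Let osc x xi := A x * cos ((p - x) * xi) + B x * sin ((p - x) * xi).

Let integrable_D (F : R -> R) : continuous F -> mu.-integrable D (EFin \o F).
Proof.
move=> cF; apply: continuous_compact_integrable; first exact: segment_compact.
exact: continuous_subspaceT.
Qed.

(** Abel summation of the inversion integral. By Fubini the frequency integral may be taken first;
    it turns e^{-e|xi|} into a Poisson kernel centred at p, and the sine part, odd in xi, vanishes.
    The truncation to the compact [D] makes the double integral absolutely convergent: the integral
    in xi of the modulus is at most (2/e)(|A| + |B|). *)
Lemma has_integral_abel_poisson :
  has_integral setT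
    (fun xi => expR (- (e * `|xi|)) * \int[mu]_(x in D) osc x xi)
    (2 * \int[mu]_(x in D) (A x * poisson e p x)).
Proof.
have mD : measurable D by exact: measurable_itv.
pose Phi (z : R * R) : R := \1_D z.2 * (expR (- (e * `|z.1|)) * osc z.2 z.1).
have mA : measurable_fun setT A by exact: continuous_measurable_fun.
have mB : measurable_fun setT B by exact: continuous_measurable_fun.
have mE : measurable_fun setT (fun xi : R => expR (- (e * `|xi|))).
  by apply: continuous_measurable_fun; exact: continuous_expRN_abs.
have mPhi : measurable_fun setT (EFin \o Phi).
  apply/measurable_EFinP; apply: measurable_funM.
    by apply: measurableT_comp => //; exact: measurable_indic.
  apply: measurable_funM.
    exact: measurableT_comp mE measurable_fst.
  have mph : measurable_fun setT (fun z : R * R => (p - z.2) * z.1).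
    by apply: measurable_funM => //; exact: measurable_funB.
  apply: measurable_funD; apply: measurable_funM.
  - exact: measurableT_comp.
  - apply: measurableT_comp mph; apply: continuous_measurable_fun.
    exact: continuous_cos.
  - exact: measurableT_comp.
  - apply: measurableT_comp mph; apply: continuous_measurable_fun.
    exact: continuous_sin.
have hE := has_integral_expRN_abs e0.
pose m x : R := (fun x => 2 / e * (`|A x| + `|B x|)) \_ D x.
have im : mu.-integrable setT (EFin \o m).
  have cAB : continuous (fun x => 2 / e * (`|A x| + `|B x|)).
    move=> x; apply: cvgM; first exact: cvg_cst.
    by apply: cvgD; apply: cvg_norm; [exact: cA|exact: cB].
  rewrite /m -restrict_EFin; apply/integrable_restrict => //=; rewrite setTI.
  exact: integrable_D cAB.
have iPhi : (mu \x mu)%E.-integrable setT (EFin \o Phi).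
  apply/integrable21ltyP => //; move/integrableP : im => [mm]; apply: le_lt_trans.
  apply: ge0_le_integral => //.
  - by move=> x _; apply: integral_ge0.
  - apply: (@measurable_fun_fubini_tonelli_G _ _ _ _ _ mu (abse \o (EFin \o Phi))) => //.
      exact: measurableT_comp.
    by move=> z; exact: abse_ge0.
  - exact: measurableT_comp.
  move=> x _; rewrite /m /= patchE; case: ifPn => xD; last first.
    rewrite integral0_eq ?normr0// => xi _.
    by rewrite /Phi /= indicE (negbTE xD) mul0r normr0.
  have hM := has_integralZ (`|A x| + `|B x|) measurableT hE.
  rewrite ger0_norm; last by rewrite mulr_ge0 ?divr_ge0 ?addr_ge0// ltW.
  rewrite [in leRHS]mulrC -(has_integral_ereal measurableT hM).
  apply: ge0_le_integral => //.
  - apply/measurable_EFinP; apply: measurableT_comp => //.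
    by have /measurable_EFinP := measurable_fun_pair1 x mPhi.
  - apply/measurable_EFinP; exact: measurable_funM.
  move=> xi _; rewrite lee_fin /Phi /= indicE xD mul1r normrM ger0_norm ?expR_ge0//.
  by rewrite [leRHS]mulrC ler_wpM2l ?expR_ge0// normr_lin_cos_sin_le.
have FUB := Fubini iPhi.
have Fxi x : (\int[mu]_xi (EFin \o Phi) (xi, x) =
    (2 * ((fun x => A x * poisson e p x) \_ D) x)%:E)%E.
  rewrite patchE; case: ifPn => xD; last first.
    rewrite integral0_eq ?mulr0// => xi _.
    by rewrite /Phi /= indicE (negbTE xD) mul0r.
  have hO : has_integral setT (fun xi => expR (- (e * `|xi|)) * osc x xi)
      (2 * A x * e / (e ^+ 2 + (p - x) ^+ 2)).
    by split; [exact: integrable_expRN_abs_osc|exact: Rintegral_expRN_abs_osc].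
  rewrite /poisson -[(x - p) ^+ 2]sqrrN opprB !mulrA -(has_integral_ereal measurableT hO).
  by apply: eq_integral => xi _; rewrite /Phi /= indicE xD mul1r.
have cosc xi : continuous (osc ^~ xi).
  have cc (F : R -> R) : (forall x, derivable F x 1) -> continuous F.
    exact: derivable_cts.
  move=> x; apply: cvgD; apply: cvgM; [exact: cA| |exact: cB|].
    by apply: (cc (fun x => cos ((p - x) * xi))) => z; apply: ex_derive.
  by apply: (cc (fun x => sin ((p - x) * xi))) => z; apply: ex_derive.
have Gx xi : (\int[mu]_x (EFin \o Phi) (xi, x) =
    (expR (- (e * `|xi|)) * \int[mu]_(x in D) osc x xi)%:E)%E.
  rewrite -RintegralZl//; last exact: integrable_D (cosc xi).
  have iO := @integrableZl _ _ R mu D mD (expR (- (e * `|xi|))) _ (integrable_D (cosc xi)).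
  rewrite /Rintegral fineK; last exact: integrable_fin_num iO.
  rewrite [RHS]integral_mkcond; apply: eq_integral => x _.
  rewrite patchE /Phi /= indicE; case: ifPn => xD; rewrite ?mul1r ?mul0r //.
split.
  have := integrable_fubini_F iPhi.
  by apply: eq_integrable => // xi _; rewrite /fubini_F Gx.
rewrite [LHS]/Rintegral; under eq_integral do rewrite -Gx.
rewrite FUB; under eq_integral do rewrite Fxi.
rewrite -/(Rintegral _ _ _) [in RHS]Rintegral_mkcond RintegralZl//.
rewrite -restrict_EFin; apply/integrable_restrict => //=; rewrite setTI.
apply: integrable_D => x; apply: cvgM; first exact: cA.
exact: continuous_poisson.
Qed.

End Fubini.

(** * Point values of f paired with its Fourier transform *)

Section FourierPairing.
Context {R : realType}.
Notation mu := (@lebesgue_measure R).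
Local Notation Re := (@complex.Re R).
Local Notation Im := (@complex.Im R).
Implicit Types (f fhat : R -> R[i]) (x xi T : R).

Lemma sqr_normc (z : R[i]) : Normc.normc z ^+ 2 = Re z ^+ 2 + Im z ^+ 2.
Proof. by case: z => a b /=; rewrite sqr_sqrtr// addr_ge0 ?sqr_ge0. Qed.

Lemma cmeasurableB (u w : R -> R[i]) :
  cmeasurable u -> cmeasurable w -> cmeasurable (fun x => u x - w x).
Proof.
move=> [u1 u2] [w1 w2]; split.
  rewrite (_ : (fun x => _) = fun x => Re (u x) - Re (w x)).
    exact: measurable_funB.
  by apply/funext => x; case: (u x) (w x) => ? ? [].
rewrite (_ : (fun x => _) = fun x => Im (u x) - Im (w x)).
  exact: measurable_funB.
by apply/funext => x; case: (u x) (w x) => ? ? [].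
Qed.

Lemma measurable_sqr_normc (g : R -> R[i]) : cmeasurable g ->
  measurable_fun setT (fun x => Normc.normc (g x) ^+ 2).
Proof.
move=> [m1 m2].
rewrite (_ : (fun x => _) = fun x => Re (g x) ^+ 2 + Im (g x) ^+ 2).
  by apply: measurable_funD; apply: measurable_funX.
by apply/funext => x; exact: sqr_normc.
Qed.

Lemma is_fourier_near f fhat (d : R) : is_fourier f fhat -> 0 < d ->
  \forall T \near +oo,
    (sqnormL2 (fun xi => trunc_fourier f T xi - fhat xi)%R <= d%:E)%E.
Proof.
move=> [_ _ /fine_cvgP[ffin /cvgrPdist_le fle]] d0; have := fle _ d0 => {}fle.
near=> T; have rf : (sqnormL2 (fun xi => trunc_fourier f T xi - fhat xi)%R) \is a fin_num.
  by near: T.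
rewrite -(fineK rf) lee_fin.
have : `|0 - fine (sqnormL2 (fun xi => trunc_fourier f T xi - fhat xi))| <= d by near: T.
by rewrite sub0r normrN; apply: le_trans; exact: ler_norm.
Unshelve. all: by end_near.
Qed.

Lemma integrable_sqr_normc_le (g : R -> R[i]) y : cmeasurable g ->
  (sqnormL2 g <= y%:E)%E ->
  mu.-integrable setT (EFin \o (fun x => Normc.normc (g x) ^+ 2)) /\
  \int[mu]_x (Normc.normc (g x) ^+ 2) <= y.
Proof.
move=> mg; apply: ge0_integrable_le; first exact: measurable_sqr_normc.
by move=> x; exact: sqr_ge0.
Qed.

Let k : R := (Num.sqrt (2 * pi))^-1.

Lemma Re_trunc_fourier f T xi : Re (trunc_fourier f T xi) =
  k * \int[mu]_(x in `[- T, T]) (Re (f x) * cos (x * xi) + Im (f x) * sin (x * xi)).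
Proof.
rewrite /trunc_fourier /cintegral /= mul0r subr0; congr (_ * _).
by apply: eq_Rintegral => x _; case: (f x) => a b /=; rewrite cosN sinN mulrN opprK.
Qed.

Lemma Im_trunc_fourier f T xi : Im (trunc_fourier f T xi) =
  k * \int[mu]_(x in `[- T, T]) (Im (f x) * cos (x * xi) - Re (f x) * sin (x * xi)).
Proof.
rewrite /trunc_fourier /cintegral /= mul0r addr0; congr (_ * _).
apply: eq_Rintegral => x _; case: (f x) => a b /=; rewrite cosN sinN mulrN.
by rewrite addrC.
Qed.

(** The Abel-regularized integrand at e = 1, p = 0 is integrable, hence measurable; multiplying by
    e^{|xi|} recovers the transform. *)
Lemma measurable_trunc_fourier f T : ccontinuous f -> cmeasurable (trunc_fourier f T).
Proof.
move=> [c1 c2].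
have mI (A B : R -> R) : continuous A -> continuous B -> measurable_fun setT
    (fun xi => \int[mu]_(x in `[- T, T]) (A x * cos (x * xi) + B x * sin (x * xi))).
  move=> cA cB; have cBN : continuous (fun x => - B x) by move=> x; apply: cvgN; exact: cB.
  have [/measurable_int iH _] := has_integral_abel_poisson T 0 cA cBN (@ltr01 R).
  rewrite (_ : (fun xi => _) = fun xi => expR (1 * `|xi|) * (expR (- (1 * `|xi|)) *
     \int[mu]_(x in `[- T, T]) (A x * cos ((0 - x) * xi) + - B x * sin ((0 - x) * xi)))).
    apply: measurable_funM; last exact/measurable_EFinP.
    by apply: measurableT_comp => //; apply: measurable_funM => //; exact: normr_measurable.
  apply/funext => xi; rewrite mulrA expRxMexpNx_1 mul1r; apply: eq_Rintegral => x _.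
  by rewrite sub0r mulNr cosN sinN mulrNN.
split.
  rewrite (_ : (fun x => _) = fun xi => k * \int[mu]_(x in `[- T, T])
      (Re (f x) * cos (x * xi) + Im (f x) * sin (x * xi))).
    by apply: measurable_funM => //; exact: mI.
  by apply/funext => xi; exact: Re_trunc_fourier.
rewrite (_ : (fun x => _) = fun xi => k * \int[mu]_(x in `[- T, T])
    (Im (f x) * cos (x * xi) + (- Re (f x)) * sin (x * xi))).
  by apply: measurable_funM => //; apply: mI => // x; apply: cvgN; exact: c1.
apply/funext => xi; rewrite Im_trunc_fourier; congr (_ * _).
by apply: eq_Rintegral => x _; rewrite mulNr.
Qed.

Section Pairing.
Variables (f fhat : R -> R[i]) (al be : R).
Hypotheses (f_cts : ccontinuous f) (f_fhat : is_fourier f fhat).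
Hypothesis alpha_beta : al ^+ 2 + be ^+ 2 = 1.
Variables (I : finType) (v p : I -> R) (c : R).
Hypothesis c0 : 0 < c.
Hypothesis fhat_weight :
  mu.-integrable setT (EFin \o (fun xi => Normc.normc (fhat xi) ^+ 2 * bessel_weight c xi)).

(** Let u = al - i be, of modulus 1. Then u f = [phi] - i [psi] and [C1] + i [C2] = u \sum_i v_i
    e^{i p_i xi}, so [C1 * Re g - C2 * Im g] is the real part of u g \sum_i v_i e^{i p_i xi}. *)
Let phi x := al * Re (f x) + be * Im (f x).
Let psi x := be * Re (f x) - al * Im (f x).
Let C1 xi := \sum_i v i * (al * cos (p i * xi) + be * sin (p i * xi)).
Let C2 xi := \sum_i v i * (al * sin (p i * xi) - be * cos (p i * xi)).

Let continuous_lin (a b : R) : continuous (fun x => a * Re (f x) + b * Im (f x)).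
Proof.
move=> x; apply: cvgD; apply: cvgM; try exact: cvg_cst.
  exact: f_cts.1.
exact: f_cts.2.
Qed.

Let has_integral_pairing T e : 0 < e ->
  has_integral setT
    (fun xi => expR (- (e * `|xi|)) *
       (C1 xi * Re (trunc_fourier f T xi) - C2 xi * Im (trunc_fourier f T xi)))
    (2 * k * \sum_i v i * \int[mu]_(x in `[- T, T]) (phi x * poisson e (p i) x)).
Proof.
move=> e0.
have cpsi : continuous psi.
  by rewrite (_ : psi = fun x => be * Re (f x) + (- al) * Im (f x)) //;
    apply/funext => x; rewrite mulNr.
pose osc i x xi := phi x * cos ((p i - x) * xi) + psi x * sin ((p i - x) * xi).
rewrite (_ : (fun _ => _) = fun xi => \sum_i (k * v i *
   (expR (- (e * `|xi|)) * \int[mu]_(x in `[- T, T]) osc i x xi))).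
  rewrite mulr_sumr; apply: has_integral_sum => // i.
  rewrite [X in has_integral _ _ X](_ : _ = k * v i *
      (2 * \int[mu]_(x in `[- T, T]) (phi x * poisson e (p i) x))); last by ring.
  apply: has_integralZ => //; apply: has_integral_abel_poisson => //.
  exact: continuous_lin.
apply/funext => xi; rewrite /C1 /C2 !mulr_suml -sumrB mulr_sumr; apply: eq_bigr => i _.
rewrite Re_trunc_fourier Im_trunc_fourier.
have iD (F : R -> R) : (forall x, {for x, continuous F}) ->
    mu.-integrable `[- T, T] (EFin \o F).
  move=> cF; apply: continuous_compact_integrable; first exact: segment_compact.
  exact: continuous_subspaceT.
have cts (a b : R -> R) : continuous a -> continuous b ->
    continuous (fun x => a x * cos (x * xi) + b x * sin (x * xi)).
  move=> ca cb x; apply: cvgD; apply: cvgM; [exact: ca| |exact: cb|].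
    by apply: (@derivable_cts _ (fun x => cos (x * xi))) => z; apply: ex_derive.
  by apply: (@derivable_cts _ (fun x => sin (x * xi))) => z; apply: ex_derive.
have iu : mu.-integrable `[- T, T] (EFin \o
    (fun x => Re (f x) * cos (x * xi) + Im (f x) * sin (x * xi))).
  apply: iD; apply: cts; [exact: f_cts.1|exact: f_cts.2].
have iw : mu.-integrable `[- T, T] (EFin \o
    (fun x => Im (f x) * cos (x * xi) - Re (f x) * sin (x * xi))).
  rewrite (_ : (fun x => _) = fun x =>
     Im (f x) * cos (x * xi) + (- Re (f x)) * sin (x * xi)).
    apply: iD; apply: cts; first exact: f_cts.2.
    by move=> x; apply: cvgN; exact: f_cts.1.
  by apply/funext => x; rewrite mulNr.
set g1 := al * cos _ + _; set g2 := al * sin _ - _.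
rewrite (_ : \int[mu]_(x in _) osc i x xi =
   g1 * \int[mu]_(x in `[- T, T]) (Re (f x) * cos (x * xi) + Im (f x) * sin (x * xi)) -
   g2 * \int[mu]_(x in `[- T, T]) (Im (f x) * cos (x * xi) - Re (f x) * sin (x * xi))).
  by ring.
have iZ (F : R -> R) a : mu.-integrable `[- T, T] (EFin \o F) ->
    mu.-integrable `[- T, T] (EFin \o (fun x => a * F x)).
  exact: (@integrableZl _ _ R mu _ (measurable_itv _) a).
rewrite -!RintegralZl// -RintegralB//; [|exact: iZ|exact: iZ].
apply: eq_Rintegral => x _; rewrite /osc /phi /psi /g1 /g2 mulrBl cosB sinB; ring.
Qed.

Let C1C2 xi : C1 xi ^+ 2 + C2 xi ^+ 2 = trigsum_sq v p xi.
Proof.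
pose Vc := \sum_i v i * cos (p i * xi); pose Vs := \sum_i v i * sin (p i * xi).
have -> : C1 xi = al * Vc + be * Vs.
  by rewrite !mulr_sumr -big_split; apply: eq_bigr => i _ /=; ring.
have -> : C2 xi = al * Vs - be * Vc.
  by rewrite !mulr_sumr -sumrB; apply: eq_bigr => i _ /=; ring.
rewrite (_ : _ + _ = (al ^+ 2 + be ^+ 2) * (Vc ^+ 2 + Vs ^+ 2)); last by ring.
by rewrite alpha_beta mul1r.
Qed.

Let M := \sum_i `|v i|.

Let trigsum_sq_le xi : trigsum_sq v p xi <= 2 * M ^+ 2.
Proof.
have M0 : 0 <= M by rewrite sumr_ge0.
have h (u : I -> R) : (forall i, `|u i| <= 1) -> (\sum_i v i * u i) ^+ 2 <= M ^+ 2.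
  move=> hu; rewrite -(real_normK (num_real (\sum_i _))) lerXn2r ?nnegrE//.
  apply: le_trans (ler_norm_sum _ _ _) _; apply: ler_sum => i _.
  by rewrite normrM -[leRHS]mulr1 ler_wpM2l.
rewrite mulr_natl mulr2n; apply: lerD; apply: h => i.
  exact: normr_cos_le1.
exact: normr_sin_le1.
Qed.

(** Young's inequality twice: with parameter eta * w for the part g ([fhat]), with 1/(kap * e) for
    the part r (the truncation residual). Here e stands for the value of e^{-e|xi|}; it is kept in
    [kap * b * e], since the constant b would not be integrable, and bounded by 1 elsewhere. *)
Let pairing_le (b eta kap e w g1 g2 r1 r2 V c1 c2 : R) : 0 < eta -> 0 < kap -> 0 < w ->
  0 < e <= 1 -> c1 ^+ 2 + c2 ^+ 2 = V -> V <= b ->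
  e * (c1 * (r1 + g1) - c2 * (r2 + g2)) <=
  2^-1 * (eta * ((g1 ^+ 2 + g2 ^+ 2) * w) + eta^-1 * (V / w) +
    (kap * b * e + kap^-1 * (r1 ^+ 2 + r2 ^+ 2))).
Proof.
move=> eta0 kap0 w0 /andP[e0 e1] cV Vb.
have young (s q r : R) : 0 < s -> c1 * q - c2 * r <= 2^-1 * (s * (q ^+ 2 + r ^+ 2) + s^-1 * V).
  move=> s0; rewrite -subr_ge0 -cV.
  have -> : 2^-1 * (s * (q ^+ 2 + r ^+ 2) + s^-1 * (c1 ^+ 2 + c2 ^+ 2)) - (c1 * q - c2 * r) =
      2^-1 * s^-1 * ((s * q - c1) ^+ 2 + (s * r + c2) ^+ 2).
    by field; exact: lt0r_neq0.
  by rewrite mulr_ge0 ?addr_ge0 ?sqr_ge0// mulr_ge0 ?invr_ge0// ltW.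
have -> : e * (c1 * (r1 + g1) - c2 * (r2 + g2)) =
    e * (c1 * g1 - c2 * g2) + (c1 * (e * r1) - c2 * (e * r2)) by ring.
have V0 : 0 <= V by rewrite -cV addr_ge0 ?sqr_ge0.
have etaw : 0 < eta * w by rewrite mulr_gt0.
rewrite [leRHS]mulrDr; apply: lerD.
  apply: (@le_trans _ _ (e * (2^-1 * (eta * w * (g1 ^+ 2 + g2 ^+ 2) + (eta * w)^-1 * V)))).
    by rewrite ler_wpM2l ?(ltW e0)// young.
  rewrite [leRHS](_ : _ = 2^-1 * (eta * w * (g1 ^+ 2 + g2 ^+ 2) + (eta * w)^-1 * V)); last first.
    by field; rewrite !lt0r_neq0.
  rewrite -[leRHS]mul1r ler_wpM2r// mulr_ge0// addr_ge0// mulr_ge0 ?addr_ge0 ?sqr_ge0 ?(ltW etaw)//.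
  by rewrite invr_ge0 ltW.
have kape : 0 < (kap * e)^-1 by rewrite invr_gt0 mulr_gt0.
apply: le_trans (young _ _ _ kape) _; rewrite invrK ler_wpM2l//.
rewrite addrC; apply: lerD.
  by rewrite mulrAC ler_wpM2r ?(ltW e0)// ler_wpM2l// ltW.
have -> : (kap * e)^-1 * ((e * r1) ^+ 2 + (e * r2) ^+ 2) =
    e * (kap^-1 * (r1 ^+ 2 + r2 ^+ 2)) by field; rewrite !lt0r_neq0.
by rewrite -[leRHS]mul1r ler_wpM2r// mulr_ge0 ?invr_ge0 ?(ltW kap0)// addr_ge0 ?sqr_ge0.
Qed.

(** Integrating [pairing_le] over xi bounds the pairing, which is close to the point functional by
    the Poisson approximation. The errors of both approximations are absorbed in an arbitrary slack
    [d]. *)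
Lemma fourier_pairing_le eta : 0 < eta ->
  2 * Num.sqrt (2 * pi) * \sum_i v i * (al * Re (f (p i)) + be * Im (f (p i))) <=
  eta * \int[mu]_xi (Normc.normc (fhat xi) ^+ 2 * bessel_weight c xi) +
  eta^-1 * (pi / Gamma (1 / 2) * imq_form v p c).
Proof.
move=> eta0; apply/ler_addgt0Pr => d d0.
have [[[mf1 mf2] f2] [[mg1 mg2] g2] cvgf] := f_fhat.
have pi0 := pi_gt0 R.
have s0 : 0 < Num.sqrt (2 * pi) :> R by rewrite sqrtr_gt0 mulr_gt0.
have k0 : 0 < k by rewrite invr_gt0.
have M0 : 0 <= M by rewrite sumr_ge0.
have kM : 0 < 4 * k * M + 1 by rewrite ltr_wpDl// !mulr_ge0// ltW.
(* The slack is spent as d/2 on the Poisson approximation and d/4 on each of the two residual terms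
   of [pairing_le]; the added 1 keeps the denominator positive when all weights vanish. *)
pose d1 := d / 2 / (4 * k * M + 1).
have d10 : 0 < d1 by rewrite !divr_gt0.
have i2 : mu.-integrable setT (EFin \o (fun x => phi x ^+ 2)).
  have [f_int _] : mu.-integrable setT (EFin \o (fun x => Normc.normc (f x) ^+ 2)) /\
      \int[mu]_x (Normc.normc (f x) ^+ 2) <= fine (sqnormL2 f).
    apply: integrable_sqr_normc_le => //; rewrite fineK// ge0_fin_numE//.
    by apply: integral_ge0 => x _; rewrite lee_fin sqr_ge0.
  apply: le_integrable f_int => //.
    apply/measurable_EFinP; apply: measurable_funX; apply: continuous_measurable_fun.
    exact: continuous_lin.
  move=> x _ /=; rewrite lee_fin !ger0_norm ?sqr_ge0// sqr_normc -[leRHS]mul1r -alpha_beta.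
  rewrite -subr_ge0 (_ : _ - _ = (al * Im (f x) - be * Re (f x)) ^+ 2) ?sqr_ge0//.
  by rewrite /phi; ring.
have [e [e0 hT]] : exists e, 0 < e /\ \forall T \near +oo, forall i,
    `|\int[mu]_(x in `[- T, T]) (phi x * poisson e (p i) x) - pi * phi (p i)| <= d1.
  have hi i : \forall e \near 0^'+, \forall T \near +oo,
      `|\int[mu]_(x in `[- T, T]) (phi x * poisson e (p i) x) - pi * phi (p i)| <= d1.
    by apply: poisson_approximation => //; exact: continuous_lin.
  have h := filterS (fun e he => filter_forall _ he) (filter_forall _ hi).
  near (0 : R)^'+ => e; exists e.
  by split; near: e; [exact: nbhs_right_gt|exact: h].
(* The mass 2/e of e^{-e|xi|} enters here, so [kap] depends on e; T is taken last, making the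
   squared L^2 residual at most kap * d/4. *)
pose kap := d / 4 / (4 * M ^+ 2 / e + 1).
have kap1 : 0 < 4 * M ^+ 2 / e + 1.
  by rewrite ltr_wpDl// divr_ge0 ?(ltW e0)// mulr_ge0 ?sqr_ge0.
have kap0 : 0 < kap by rewrite !divr_gt0.
have kd0 : 0 < kap * (d / 4) by rewrite mulr_gt0// divr_gt0.
pose r T xi := trunc_fourier f T xi - fhat xi.
have [T [rT hTT]] : exists T, (sqnormL2 (r T) <= (kap * (d / 4))%:E)%E /\ forall i,
    `|\int[mu]_(x in `[- T, T]) (phi x * poisson e (p i) x) - pi * phi (p i)| <= d1.
  have rle := is_fourier_near f_fhat kd0.
  by near +oo_R => T; exists T; split; near: T.
have mr : cmeasurable (r T).
  by apply: cmeasurableB => //; exact: measurable_trunc_fourier.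
have [hr hrle] := integrable_sqr_normc_le mr rT.
have [hV hVle] : mu.-integrable setT
      (EFin \o (fun xi => trigsum_sq v p xi / bessel_weight c xi)) /\
    \int[mu]_xi (trigsum_sq v p xi / bessel_weight c xi) <=
    pi / Gamma (1 / 2) * imq_form v p c.
  apply: ge0_integrable_le.
  - apply: measurable_funM; last exact: measurable_bessel_weightV.
    by apply: continuous_measurable_fun; exact: continuous_trigsum_sq.
  - by move=> x; rewrite divr_ge0 ?trigsum_sq_ge0// ltW// bessel_weight_gt0.
  - exact: integral_trigsum_sq_weight_le.
have hE := has_integral_expRN_abs e0.
have [iJ eJ] := has_integral_pairing T e0.
set A' := \int[mu]_xi (_ * bessel_weight c xi).
set V' := \int[mu]_xi (trigsum_sq v p xi / bessel_weight c xi) in hVle.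
set r2 := \int[mu]_xi (Normc.normc (r T xi) ^+ 2) in hrle.
have hU := has_integralZ 2^-1 measurableT
  (has_integralD measurableT
    (has_integralD measurableT
      (has_integralZ eta measurableT (conj fhat_weight (erefl A')))
      (has_integralZ eta^-1 measurableT (conj hV (erefl V'))))
    (has_integralD measurableT
      (has_integralZ (kap * (2 * M ^+ 2)) measurableT hE)
      (has_integralZ kap^-1 measurableT (conj hr (erefl r2))))).
have [iU eU] := hU.
have JU : 2 * k * \sum_i v i * \int[mu]_(x in `[- T, T]) (phi x * poisson e (p i) x) <=
    2^-1 * (eta * A' + eta^-1 * V' + (kap * (2 * M ^+ 2) * (2 / e) + kap^-1 * r2)).
  rewrite -eJ -eU; apply: le_Rintegral => // xi _.
  rewrite !sqr_normc.
  have -> : trunc_fourier f T xi = r T xi + fhat xi by rewrite subrK.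
  rewrite (_ : Re (r T xi + fhat xi) = Re (r T xi) + Re (fhat xi)); last first.
    by case: (r T xi) (fhat xi) => a b [].
  rewrite (_ : Im (r T xi + fhat xi) = Im (r T xi) + Im (fhat xi)); last first.
    by case: (r T xi) (fhat xi) => a b [].
  apply: pairing_le => //; first exact: bessel_weight_gt0.
  by rewrite expR_gt0 expR_le1 oppr_le0 mulr_ge0 ?(ltW e0).
set J := \sum_i v i * _ in JU.
have JS : pi * \sum_i v i * phi (p i) - d1 * M <= J.
  rewrite /J /M !mulr_sumr -sumrB; apply: ler_sum => i _.
  have := hTT i; rewrite -subr_ge0; set Ji := \int[mu]_(x in _) _ => hi.
  have : `|v i * (Ji - pi * phi (p i))| <= `|v i| * d1.
    by rewrite normrM ler_wpM2l// -subr_ge0.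
  by rewrite ler_norml => /andP[+ _]; lra.
have kpi : 2 * k * pi = Num.sqrt (2 * pi).
  rewrite mulrAC -[RHS](mulfK (lt0r_neq0 s0)) -expr2 sqr_sqrtr//.
  by rewrite mulr_ge0// ltW.
have d1E : d1 * (4 * k * M + 1) = d / 2 by rewrite mulfVK// lt0r_neq0.
have kapE : kap * (4 * M ^+ 2 / e + 1) = d / 4 by rewrite mulfVK// lt0r_neq0.
have r2E : kap^-1 * r2 <= d / 4 by rewrite ler_pdivrMl.
have VE : eta^-1 * V' <= eta^-1 * (pi / Gamma (1 / 2) * imq_form v p c).
  by rewrite ler_wpM2l// invr_ge0 ltW.
have kJ : 2 * k * (pi * \sum_i v i * phi (p i) - d1 * M) <= 2 * k * J.
  by rewrite ler_wpM2l// mulr_ge0// ltW.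
move: kJ; rewrite mulrBr mulrA kpi => kJ.
rewrite -/(\sum_i v i * phi (p i)) -mulrA.
set S := Num.sqrt _ * _ in kJ *.
have kE : kap * (2 * M ^+ 2) * (2 / e) = kap * (4 * M ^+ 2 / e).
  by field; rewrite lt0r_neq0.
rewrite kE in JU.
lra.
Unshelve. all: by end_near.
Qed.

End Pairing.
End FourierPairing.

(** * Interpolation nodes *)

Section Nodes.
Context {R : realType}.

Lemma fill_distance_near (b d : R) (E : set R) N (x : 'I_N -> R) y :
  interval_of_length b E -> (forall i, E (x i)) ->
  0 < d -> fill_distance (range x) E < d -> 0 < fill_distance (range x) E ->
  E y -> exists i, `|y - x i| < d.
Proof.
move=> [a [l [r EE]]] xE d0 fd f0 Ey.
have EI z : E z -> a <= z <= a + b.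
  rewrite EE {EE}; case: l; case: r; rewrite /= in_itv /= => /andP[? ?];
    by apply/andP; split; lra.
(* Without nodes every infimum is that of the empty set, 0 by convention, and the fill distance
   would be 0, against its positivity. *)
have [i0 _] : exists i0 : 'I_N, True.
  case: N x xE fd f0 => [|n] x xE fd f0; last by exists ord0.
  move: f0; rewrite /fill_distance (_ : range x = set0).
    rewrite (_ : [set _ | y in E] = [set 0]) ?sup1 ?ltxx//.
    apply/seteqP; split => [_ [z _ <-]|_ ->]; first by rewrite image_set0 inf0.
    by exists y => //; rewrite image_set0 inf0.
  by apply/seteqP; split => // z [[]].
pose S z : set R := [set `|z - w| | w in range x].
have Sinf z : has_inf (S z).
  split; first by exists `|z - x i0|; exists (x i0).
  by exists 0 => _ [w _ <-].
have le_fd : inf (S y) <= fill_distance (range x) E.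
  apply: ub_le_sup; last by exists y.
  exists b => _ [z Ez <-].
  apply: (@le_trans _ _ `|z - x i0|).
    by apply: ge_inf; [case: (Sinf z)|exists (x i0)].
  have := EI _ Ez; have := EI _ (xE i0).
  by rewrite ler_norml => /andP[? ?] /andP[? ?]; apply/andP; split; lra.
have e0 : 0 < d - inf (S y) by rewrite subr_gt0 (le_lt_trans le_fd).
have [_ [_ [i _ <-] <-]] := inf_adherent e0 (Sinf y).
by rewrite subrKC => h; exists i.
Qed.

Lemma exists_nodes (b : R) (E : set R) N (x : 'I_N -> R) (k : nat) t :
  let d := fill_distance (range x) E in
  interval_of_length b E -> (forall i, E (x i)) -> 0 < d ->
  4 * k%:R * d <= b -> E t ->
  exists iota : 'I_k -> 'I_N,
    injective (x \o iota) /\ forall j, `|t - x (iota j)| <= 4 * k%:R * d.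
Proof.
move=> d Eb xE d0 kb Et; have [a [l [r EE]]] := Eb.
(* The window [o, o + D] starts at t, or is pushed left just enough to end at a + b; it contains t
   and stays between the ends of E. *)
pose D := 4 * k%:R * d; pose o := Num.min t (a + b - D).
have /andP[at_ tb] : a <= t <= a + b.
  move: Et; rewrite EE {EE}; case: l; case: r; rewrite /= in_itv /= => /andP[? ?];
    by apply/andP; split; lra.
have D0 : 0 <= D by rewrite !mulr_ge0// ltW.
have ao : a <= o by rewrite le_min at_ /=; rewrite /D; lra.
have oD : o + D <= a + b by rewrite -lerBrDr ge_min lexx orbT.
have ot : o <= t by rewrite ge_min lexx.
have tD : t <= o + D by rewrite -lerBlDr le_min; apply/andP; split; lra.
(* The centre of the j-th cell is interior to E, whatever endpoints E has, and d < 2d gives a strict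
   bound: the node lies in the open cell, so different cells give different nodes. *)
have cell (j : 'I_k) : exists i, `|o + 4 * d * j%:R + 2 * d - x i| < 2 * d.
  apply: (fill_distance_near Eb xE) => //; first by rewrite mulr_gt0.
    by rewrite -/d; lra.
  have jk : (j%:R + 1 : R) <= k%:R by rewrite natr1 ler_nat.
  have j0 : 0 <= j%:R :> R by [].
  have h1 : a < o + 4 * d * j%:R + 2 * d by nra.
  have h2 : o + 4 * d * j%:R + 2 * d < a + b by rewrite /D in oD; nra.
  rewrite EE {EE}; case: l; case: r;
    by rewrite /= in_itv /= ?h1 ?h2 ?(ltW h1) ?(ltW h2).
have [iota hi] := choice cell; exists iota; split.
  have lt (i j : 'I_k) : (i < j)%N -> x (iota i) < x (iota j).
    move=> ij; have := hi i; have := hi j; rewrite !ltr_distlC => /andP[h1 h2] /andP[h3 h4].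
    have : (i%:R + 1 : R) <= j%:R by rewrite natr1 ler_nat.
    nra.
  move=> i j /= e; apply/val_inj => /=; case: (ltngtP i j) => // /lt; rewrite e ltxx //.
move=> j; have := hi j; rewrite ltr_distlC => /andP[h1 h2].
have jk : (j%:R + 1 : R) <= k%:R by rewrite natr1 ler_nat.
have j0 : 0 <= j%:R :> R by [].
rewrite ler_norml; apply/andP; split; rewrite -/D; rewrite /D in tD *; nra.
Qed.

End Nodes.

(** * The weighted norm of the transform in terms of A and B *)

Section WeightedNorm.
Context {R : realType}.
Notation mu := (@lebesgue_measure R).
Local Notation Re := (@complex.Re R).
Local Notation Im := (@complex.Im R).

Lemma normc_ge0 (z : R[i]) : 0 <= Normc.normc z.
Proof. by case: z => a b; exact: sqrtr_ge0. Qed.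

(** Both are limits in the mean of the same truncated transforms, and |g1 - g2|^2 <= 2(|h - g1|^2 +
    |h - g2|^2). It carries the vanishing outside the band, which [band_limited] asserts for some
    transform, over to the given one. *)
Lemma fourier_unique (f g1 g2 : R -> R[i]) : ccontinuous f ->
  is_fourier f g1 -> is_fourier f g2 -> {ae mu, forall xi, g1 xi = g2 xi}.
Proof.
move=> cf fg1 fg2; have [_ [mg1 _] _] := fg1; have [_ [mg2 _] _] := fg2.
pose g x := g1 x - g2 x.
have mg : cmeasurable g by exact: cmeasurableB.
have small d : 0 < d -> (sqnormL2 g <= (4 * d)%:E)%E.
  move=> d0.
  have sm1 := is_fourier_near fg1 d0; have sm2 := is_fourier_near fg2 d0.
  near +oo_R => T.
  have n1 : (sqnormL2 (fun xi => trunc_fourier f T xi - g1 xi)%R <= d%:E)%E by near: T.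
  have n2 : (sqnormL2 (fun xi => trunc_fourier f T xi - g2 xi)%R <= d%:E)%E by near: T.
  have mt := measurable_trunc_fourier T cf.
  have [i1 h1] := integrable_sqr_normc_le (cmeasurableB mt mg1) n1.
  have [i2 h2] := integrable_sqr_normc_le (cmeasurableB mt mg2) n2.
  have hU := has_integralZ 2 measurableT
     (has_integralD measurableT (conj i1 erefl) (conj i2 erefl)).
  apply: (@le_trans _ _ (\int[mu]_x (2 *
    (Normc.normc (trunc_fourier f T x - g1 x) ^+ 2 +
     Normc.normc (trunc_fourier f T x - g2 x) ^+ 2))%:E)%E).
    apply: ge0_le_integral => //.
    - by move=> x _; rewrite lee_fin sqr_ge0.
    - by apply/measurable_EFinP; exact: measurable_sqr_normc.
    - exact: measurable_int hU.1.
    move=> x _; rewrite lee_fin !sqr_normc /g.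
    case: (trunc_fourier f T x) (g1 x) (g2 x) => [a b] [a1 b1] [a2 b2] /=.
    rewrite -subr_ge0 (_ : _ - _ = (2 * a - a1 - a2) ^+ 2 + (2 * b - b1 - b2) ^+ 2).
      by rewrite addr_ge0 ?sqr_ge0.
    by ring.
  rewrite (has_integral_ereal measurableT hU) lee_fin; lra.
have mgn : measurable_fun setT (fun x => (Normc.normc (g x) ^+ 2)%:E).
  by apply/measurable_EFinP; exact: measurable_sqr_normc.
have g0 : (\int[mu]_x `|(Normc.normc (g x) ^+ 2)%:E| = 0)%E.
  transitivity (sqnormL2 g).
    by apply: eq_integral => x _; rewrite /= ger0_norm ?sqr_ge0.
  apply/eqP; rewrite eq_le; apply/andP; split; last first.
    by apply: integral_ge0 => x _; rewrite lee_fin sqr_ge0.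
  apply/lee_addgt0Pr => d d0; rewrite add0e.
  by rewrite (_ : d = 4 * (d / 4)); [apply: small; rewrite divr_gt0|field].
have := (ae_eq_integral_abs mu measurableT mgn).1 g0.
apply: filterS => x /= /(_ Logic.I) [] /eqP.
rewrite sqrf_eq0 => /eqP h; apply/eqP; rewrite -subr_eq0; apply/eqP.
exact: Normc.eq0_normc.
Unshelve. all: by end_near.
Qed.

(** For c|xi| <= 1 the Bessel weight is the constant of A; beyond, it is e^2 times the weight of B,
    and [kap] divides out the numerical constant of B. On the band the weight of B is bounded by its
    value at sigma, whence integrability. *)
Lemma weighted_norm_le c sigma (fhat : R -> R[i]) : 0 < c -> inL2 fhat ->
  {ae mu, forall xi : R, sigma < `|xi| -> fhat xi = 0} ->
  let kap := expR 2 / (2 * Num.sqrt 3 * Gamma (1 / 2) / Num.sqrt pi) in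
  mu.-integrable setT (EFin \o (fun xi => Normc.normc (fhat xi) ^+ 2 * bessel_weight c xi))
  /\ \int[mu]_xi (Normc.normc (fhat xi) ^+ 2 * bessel_weight c xi) <=
     termA c fhat + kap * termB c sigma fhat.
Proof.
move=> c0 [mf f2] fae kap.
pose SA := [set xi : R | `|xi| <= 1 / c].
pose SB := [set xi : R | 1 / c < `|xi| <= sigma].
have mnorm : measurable_fun setT (fun x : R => `|x|) by exact: normr_measurable.
have mSA : measurable SA.
  rewrite -[SA]setTI; exact: (measurable_fun_ler mnorm (measurable_cst _)).
have mSB : measurable SB.
  rewrite (_ : SB = [set xi | 1 / c < `|xi|] `&` [set xi | `|xi| <= sigma]).
    apply: measurableI; rewrite -[X in measurable X]setTI.
      exact: (measurable_fun_ltr (measurable_cst _) mnorm).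
    exact: (measurable_fun_ler mnorm (measurable_cst _)).
  by apply/seteqP; split => x /=; [move=> /andP[]|case=> *; apply/andP].
pose h1 xi := Normc.normc (fhat xi) ^+ 2.
pose h2 xi := Normc.normc (fhat xi) ^+ 2 * Num.sqrt (c * `|xi|) * expR (c * `|xi|).
have mh1 : measurable_fun setT h1 by exact: measurable_sqr_normc.
have h10 x : 0 <= h1 x by exact: sqr_ge0.
have h20 x : 0 <= h2 x.
  by rewrite mulr_ge0 ?expR_ge0// mulr_ge0 ?sqr_ge0 ?sqrtr_ge0.
have ih1 : mu.-integrable setT (EFin \o h1).
  have [] := @integrable_sqr_normc_le _ fhat (fine (sqnormL2 fhat)) mf.
    rewrite fineK// ge0_fin_numE//.
    by apply: integral_ge0 => x _; rewrite lee_fin sqr_ge0.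
  by [].
have mcx : measurable_fun setT (fun x : R => c * `|x|).
  by apply: measurable_funM.
have mh2 : measurable_fun setT h2.
  apply: measurable_funM; last exact: measurableT_comp.
  apply: measurable_funM => //; apply: measurableT_comp mcx.
  by apply: continuous_measurable_fun; exact: sqrt_continuous.
have hA : has_integral setT (h1 \_ SA) (\int[mu]_(x in SA) h1 x).
  split; last by rewrite [in RHS]Rintegral_mkcond.
  rewrite -restrict_EFin; apply/integrable_restrict => //=; rewrite setTI.
  exact: integrableS ih1.
have hB : has_integral setT (h2 \_ SB) (\int[mu]_(x in SB) h2 x).
  split; last by rewrite [in RHS]Rintegral_mkcond.
  have iK := @integrableZl _ _ R mu _ measurableT
    (Num.sqrt (c * sigma) * expR (c * sigma)) _ ih1.
  apply: le_integrable iK => //.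
    apply/measurable_EFinP; apply/(measurable_restrictT _ mSB).
    exact: measurable_funTS.
  move=> x _ /=; rewrite lee_fin patchE; case: ifPn => [|_].
    rewrite inE => /andP[_ xs]; have cxs : c * `|x| <= c * sigma.
      by rewrite ler_wpM2l ?(ltW c0).
    rewrite /h2 -mulrA mulrC !normrM ler_wpM2r//.
    rewrite !(ger0_norm (sqrtr_ge0 _)) !(ger0_norm (expR_ge0 _)).
        by apply: ler_pM; rewrite ?sqrtr_ge0 ?expR_ge0 ?ler_wsqrtr ?ler_expR.
  by rewrite normr0.
have hU := has_integralD measurableT
  (has_integralZ (besselK 0 1)^-1 measurableT hA)
  (has_integralZ (expR 2) measurableT hB).
have -> : termA c fhat + kap * termB c sigma fhat =
    (besselK 0 1)^-1 * \int[mu]_(x in SA) h1 x + expR 2 * \int[mu]_(x in SB) h2 x.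
  rewrite /termA div1r; congr (_ + _); rewrite /termB; case: ifPn => cs.
    set KB := 2 * _ * _ / _; rewrite /kap -/KB mulrA divfK//.
    have G0 := @Gamma_half_gt0 R.
    by rewrite lt0r_neq0// divr_gt0 ?sqrtr_gt0 ?pi_gt0// !mulr_gt0 ?sqrtr_gt0.
  rewrite mulr0 (_ : SB = set0) ?Rintegral_set0 ?mulr0//.
  apply/seteqP; split => // x /andP[x1 x2]; move: cs; rewrite -ltNge => sc.
  by have := lt_trans (lt_le_trans x1 x2) sc; rewrite ltxx.
apply: ge0_integrable_le.
- by apply: measurable_funM => //; exact: measurable_bessel_weight.
- by move=> x; rewrite mulr_ge0 ?sqr_ge0// ltW// bessel_weight_gt0.
rewrite -(has_integral_ereal measurableT hU).
apply: ae_ge0_le_integral => //.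
- by move=> x _; rewrite lee_fin mulr_ge0 ?h10// ltW// bessel_weight_gt0.
- apply/measurable_EFinP; apply: measurable_funM => //; exact: measurable_bessel_weight.
- move=> x _; rewrite lee_fin addr_ge0// mulr_ge0 ?expR_ge0//.
  + by rewrite invr_ge0 ltW// besselK01_gt0.
  + by rewrite patchE; case: ifPn.
  + by rewrite patchE; case: ifPn.
- exact: measurable_int hU.1.
move: fae; apply: filterS; first exact: (ae_filter_ringOfSetsType mu).
move=> x fx _; rewrite lee_fin !patchE.
have xA : (x \in SA) = (c * `|x| <= 1).
  by apply/idP/idP; rewrite inE /SA /= ler_pdivlMr// mulrC.
rewrite xA /bessel_weight; case: ifPn => cx.
  by rewrite mulrC lerDl mulr_ge0 ?expR_ge0//; case: ifPn.
have [xs|sx] := leP `|x| sigma; last first.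
  rewrite fx// /Normc.normc /= expr0n /= addr0 sqrtr0 expr0n mul0r mulr0 add0r.
  by rewrite mulr_ge0 ?expR_ge0//; case: ifPn.
rewrite mem_set; last first.
  by rewrite /SB /= xs andbT ltr_pdivrMr// mulrC ltNge.
by rewrite mulr0 add0r /h2 expRD le_eqVlt; apply/orP; left; apply/eqP; ring.
Qed.

End WeightedNorm.

(** * The error bound *)

Section Kriging.
Context {R : realType}.
Implicit Types (c t x y tau : R).

(** Returns from the family of Young bounds to Cauchy-Schwarz: eta = x/y gives y^2 <= a x when x >
    0, and for x = 0 the small value eta = y/(a + 1) forces y <= 0. *)
Lemma le_sqrt_mul (a x y : R) : 0 <= a -> 0 <= x ->
  (forall eta, 0 < eta -> 2 * y <= eta * a + eta^-1 * x) -> y <= Num.sqrt (a * x).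
Proof.
move=> a0 x0 h; rewrite leNgt; apply/negP => axy.
have y0 : 0 < y by exact: le_lt_trans (sqrtr_ge0 _) axy.
have : a * x < y ^+ 2.
  by rewrite -(sqr_sqrtr (mulr_ge0 a0 x0)) ltrXn2r ?nnegrE ?sqrtr_ge0// ltW.
move=> axy2; have [x_le0|x_gt0] := leP x 0.
  have a10 : 0 < a + 1 by rewrite ltr_wpDl.
  have z0 : 0 < y / (a + 1) by exact: divr_gt0.
  have xE : x = 0 by apply/eqP; rewrite eq_le x_le0.
  have := h _ z0; rewrite xE mulr0 addr0.
  rewrite -[X in 2 * X <= _](divfK (lt0r_neq0 a10)).
  by move: (y / (a + 1)) z0 => z z0; nra.
have := h _ (divr_gt0 x_gt0 y0); rewrite invf_div divfK ?lt0r_neq0//.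
rewrite mulr_natl mulr2n lerD2r mulrAC ler_pdivlMr// -expr2 mulrC => yy.
by move: axy2; rewrite ltNge yy.
Qed.

Lemma imqN c x : imq c (- x) = imq c x.
Proof. by rewrite /imq sqrrN. Qed.

Lemma imq_form_ge0 (I : finType) (v p : I -> R) c : 0 < c -> 0 <= imq_form v p c.
Proof.
move=> c0; have G0 := @Gamma_half_gt0 R.
rewrite -(pmulr_rge0 _ (divr_gt0 (pi_gt0 R) G0)) -lee_fin.
apply: le_trans (integral_trigsum_sq_weight_le v p c0).
apply: integral_ge0 => x _.
by rewrite lee_fin divr_ge0 ?trigsum_sq_ge0// ltW// bessel_weight_gt0.
Qed.

(** A sum of two functionals is indexed by the disjoint union, so points common to both families
    simply occur twice. *)
Definition sum_weight (I J : finType) (v : I -> R) (w : J -> R) (s : I + J) : R :=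
  match s with inl i => v i | inr j => w j end.

Lemma imq_form_sum (I J : finType) (v p : I -> R) (w q : J -> R) c tau :
  imq_form (sum_weight v (fun j => - (tau * w j))) (sum_weight p q) c =
  imq_form v p c - 2 * tau * \sum_i \sum_j v i * w j * imq c (p i - q j) +
  tau ^+ 2 * imq_form w q c.
Proof.
rewrite /imq_form big_sumType /=.
under eq_bigr do rewrite big_sumType /=.
under [X in _ + X]eq_bigr do rewrite big_sumType /=.
rewrite !big_split /=.
set A := \sum_i \sum_j _; set X := \sum_i \sum_j v i * w j * _.
have -> : \sum_i \sum_j v i * - (tau * w j) * imq c (p i - q j) = - (tau * X).
  rewrite mulr_sumr -sumrN; apply: eq_bigr => i _; rewrite mulr_sumr -sumrN.
  by apply: eq_bigr => j _; ring.
have -> : \sum_j \sum_i - (tau * w j) * v i * imq c (q j - p i) = - (tau * X).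
  rewrite exchange_big mulr_sumr -sumrN; apply: eq_bigr => i _; rewrite mulr_sumr -sumrN.
  by apply: eq_bigr => j _; rewrite -imqN opprB; ring.
have -> : \sum_i \sum_j - (tau * w i) * - (tau * w j) * imq c (q i - q j) =
    tau ^+ 2 * \sum_i \sum_j w i * w j * imq c (q i - q j).
  rewrite mulr_sumr; apply: eq_bigr => i _; rewrite mulr_sumr.
  by apply: eq_bigr => j _; ring.
ring.
Qed.

Definition error_weight k (u : 'I_k -> R) (i : 'I_k.+1) : R :=
  if unlift ord0 i is Some j then - u j else 1.

Definition error_node k (z : 'I_k -> R) t (i : 'I_k.+1) : R :=
  if unlift ord0 i is Some j then z j else t.

Lemma sum_error k (u z : 'I_k -> R) t (F : R -> R) :
  \sum_i error_weight u i * F (error_node z t i) = F t - \sum_i u i * F (z i).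
Proof.
rewrite big_ord_recl /error_weight /error_node unlift_none mul1r; congr (_ + _).
by rewrite -sumrN; apply: eq_bigr => i _; rewrite liftK mulNr.
Qed.

(* Minimality of the interpolant: moving the weights v along the direction of
   the interpolant itself removes the contribution of s to the functional, and
   does not increase the quadratic form. *)
Lemma interpolation_error_le (phi : R -> R) c K N (x al : 'I_N -> R) k
    (u : 'I_k -> R) (iota : 'I_k -> 'I_N) t : 0 < c -> 0 <= K ->
  let s y := \sum_j al j * imq c (y - x j) in
  (forall (J : finType) (v p : J -> R),
    \sum_j v j * phi (p j) <= Num.sqrt (K * imq_form v p c)) ->
  (forall j, s (x j) = phi (x j)) ->
  phi t - s t <= Num.sqrt (K * imq_form (error_weight u) (error_node (x \o iota) t) c).
Proof.
move=> c0 K0 s hphi sx.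
set v := error_weight u; set p := error_node _ _; set Q := imq_form v p c.
pose X := \sum_i \sum_j v i * al j * imq c (p i - x j).
pose S := imq_form al x c.
have S0 : 0 <= S by exact: imq_form_ge0.
have Q0 : 0 <= Q by exact: imq_form_ge0.
have vs : \sum_i v i * s (p i) = X.
  by apply: eq_bigr => i _; rewrite mulr_sumr; apply: eq_bigr => j _; rewrite mulrA.
have vphi : \sum_i v i * phi (p i) = phi t - s t + X.
  rewrite -vs /v /p !sum_error.
  rewrite (eq_bigr (fun i => u i * s ((x \o iota) i))); last by move=> i _; rewrite /= sx.
  by rewrite addrA subrK.
have alphi : \sum_j al j * phi (x j) = S.
  rewrite /S /imq_form; apply: eq_bigr => i _; rewrite -sx /s mulr_sumr.
  by apply: eq_bigr => j _; rewrite mulrA.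
have key tau : phi t - s t + X - tau * S <= Num.sqrt (K * (Q - 2 * tau * X + tau ^+ 2 * S)).
  have := hphi _ (sum_weight v (fun j => - (tau * al j))) (sum_weight p x).
  rewrite imq_form_sum big_sumType /= vphi.
  rewrite (_ : \sum_i - (tau * al i) * phi (x i) = - (tau * S)) //.
  by rewrite -alphi mulr_sumr -sumrN; apply: eq_bigr => j _; rewrite mulNr mulrA.
have pos tau : 0 <= Q - 2 * tau * X + tau ^+ 2 * S.
  by rewrite -imq_form_sum; exact: imq_form_ge0.
move: S0; rewrite le_eqVlt => /predU1P[S0|S0].
  (* For S = 0 the form is Q - 2 tau X, affine in tau and nonnegative for all tau; the chosen tau
     would give it the value -1. *)
  have X0 : X = 0.
    apply/eqP/negP => /negP X0; have := pos ((Q + 1) / (2 * X)).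
    rewrite -S0 mulr0 addr0 (_ : 2 * _ * X = Q + 1); last by field.
    by lra.
  by have := key 0; rewrite X0 -S0 !mulr0 !addr0 !subr0.
have S00 := lt0r_neq0 S0.
(* The same tau cancels X on the left and minimizes the form on the right, to Q - X^2/S. *)
have := key (X / S); rewrite mulfVK// addrK => /le_trans; apply.
apply: ler_wsqrtr; rewrite ler_wpM2l//.
rewrite (_ : _ - _ + _ = Q - X ^+ 2 / S); last by field.
by rewrite lerBlDr lerDl divr_ge0 ?sqr_ge0// ltW.
Qed.

End Kriging.

(** * The form at Lagrange weights, and the numerical constants *)

Section ErrorBound.
Context {R : realType}.

Lemma trigsum_sq_error_le k (z : 'I_k -> R) t (D xi : R) :
  injective z -> (forall i, `|t - z i| <= D) ->
  trigsum_sq (error_weight (lagrange_weight z t)) (error_node z t) xi <=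
  2 * (D ^+ k / k`!%:R) ^+ 2 * `|xi| ^+ (k + k).
Proof.
move=> zI zD; rewrite /trigsum_sq.
rewrite (sum_error _ _ _ (fun y => cos (y * xi))) (sum_error _ _ _ (fun y => sin (y * xi))).
set u := lagrange_weight z t.
have hc : `|cos (t * xi) - \sum_i u i * cos (z i * xi)| <= (D * `|xi|) ^+ k / k`!%:R.
  have := cos_interpolation_error xi 0 zI zD; rewrite addr0.
  by under eq_bigr do rewrite addr0.
have hs : `|sin (t * xi) - \sum_i u i * sin (z i * xi)| <= (D * `|xi|) ^+ k / k`!%:R.
  have := cos_interpolation_error xi (pi / 2) zI zD; rewrite cosDpihalf.
  under eq_bigr do rewrite cosDpihalf mulrN.
  by rewrite sumrN opprK addrC -normrN opprB.
have sq (a b : R) : `|a| <= b -> a ^+ 2 <= b ^+ 2.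
  move=> ab; rewrite -(real_normK (num_real a)) lerXn2r ?nnegrE//.
  exact: le_trans ab.
apply: le_trans (lerD (sq _ _ hc) (sq _ _ hs)) _.
by rewrite [(D * _) ^+ k]exprMn exprD le_eqVlt; apply/orP; left; apply/eqP; ring.
Qed.

(** The central binomial coefficient is one term of the expansion of (1 + 1)^{2k}. *)
Lemma fact_double_le k : ((k + k)`! <= 4 ^ k * (k`! * k`!))%N.
Proof.
rewrite -(bin_fact (leq_addl k k)) addnK leq_mul2r; apply/orP; right.
rewrite (_ : 4 ^ k = 2 ^ (k + k))%N; last by rewrite expnD -expnMn.
rewrite -[2%N]/(1 + 1)%N expnDn.
have kk : (k < (k + k).+1)%N by rewrite ltnS leq_addl.
by rewrite (bigD1 (Ordinal kk))//= !exp1n !muln1 leq_addr.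
Qed.

(** The (2k)! from integrating |xi|^{2k} meets the (k!)^{-2} of the squared Lagrange error, so only
    4^k remains, and 4^k D^{2k} (2/c)^{2k} = (4D/c)^{2k}. *)
Lemma imq_form_error_le k (z : 'I_k -> R) t (D c : R) : 0 < c -> 0 <= D ->
  injective z -> (forall i, `|t - z i| <= D) ->
  imq_form (error_weight (lagrange_weight z t)) (error_node z t) c <=
  4 * Gamma (1 / 2) * (4 * D / c) ^+ (k + k) / c.
Proof.
move=> c0 D0 zI zD.
have G0 := @Gamma_half_gt0 R.
have k0 : 0 < k`!%:R :> R by rewrite ltr0n fact_gt0.
have B0 : 0 <= 2 * (D ^+ k / k`!%:R) ^+ 2 by rewrite mulr_ge0 ?sqr_ge0.
apply: le_trans (imq_form_le c0 B0 (fun xi => trigsum_sq_error_le xi zI zD)) _.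
rewrite ler_wpM2r ?invr_ge0 ?(ltW c0)//.
have : (k + k)`!%:R <= 4 ^+ k * (k`!%:R * k`!%:R) :> R.
  by rewrite -natrX -!natrM ler_nat fact_double_le.
move=> h; rewrite (_ : _ * _ = (4 * Gamma (1 / 2) * ((D ^+ k / k`!%:R) ^+ 2 *
   (2 / c) ^+ (k + k))) * (k + k)`!%:R); last by ring.
rewrite [leRHS](_ : _ = (4 * Gamma (1 / 2) * ((D ^+ k / k`!%:R) ^+ 2 *
   (2 / c) ^+ (k + k))) * (4 ^+ k * (k`!%:R * k`!%:R))).
  by rewrite ler_wpM2l// !mulr_ge0 ?sqr_ge0 ?exprn_ge0 ?divr_ge0 ?(ltW c0) ?(ltW G0).
have -> : (4 * D / c) ^+ (k + k) = (2 / c) ^+ (k + k) * (2 * D) ^+ (k + k).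
  by rewrite -exprMn; congr (_ ^+ _); field; rewrite lt0r_neq0.
have -> : (2 * D) ^+ (k + k) = 4 ^+ k * (D ^+ k * D ^+ k).
  by rewrite exprD -!exprMn; congr (_ ^+ _); ring.
by field; rewrite lt0r_neq0.
Qed.

(** With q = e^{-4}, 4D/c <= (2/3)(2q). The powers of 2/3 give the rate because y <= k; the rest is
    at most (2q)^2, and 2 e^3 (2q)^2 = 8 (e^3 q) q <= 2 pi since e^3 q <= 1/2 and q <= 1/8. *)
Lemma numeric_bound (a b c C D y : R) k : 0 < c -> 0 < D -> (0 < k)%N ->
  2 / c * expR 4 <= C -> D <= 2 / (3 * C) -> y <= k%:R -> 0 <= a -> 0 <= b ->
  2 * (a + expR 3 * b) * (4 * D / c) ^+ (k + k) / c <=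
  2 * pi * ((2 / 3) `^ y) ^+ 2 * ((a + b) / c).
Proof.
move=> c0 D0 k0 cC DC yk a0 b0; pose q : R := expR (- 4).
have q0 : 0 < q by exact: expR_gt0.
have C0 : 0 < C by apply: lt_le_trans cC; rewrite mulr_gt0 ?expR_gt0// divr_gt0.
have eq : expR 4 * q = 1 by rewrite expRxMexpNx_1.
have Dc : 4 * D / c <= 2 / 3 * (2 * q).
  rewrite ler_pdivrMr//; apply: (@le_trans _ _ (4 * (2 / (3 * C)))).
    by rewrite ler_wpM2l.
  rewrite mulrA ler_pdivrMr ?mulr_gt0//.
  have -> : 4 * 2 = 2 / 3 * (2 * q) * c * (3 * (2 / c * expR 4)).
    transitivity (8 * (expR 4 * q)); first by rewrite eq; ring.
    by field; rewrite lt0r_neq0.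
  have qc0 : 0 <= 2 / 3 * (2 * q) * c by rewrite !mulr_ge0 ?(ltW q0) ?(ltW c0)// divr_ge0.
  by rewrite ler_wpM2l// ler_wpM2l.
have e2 : 2 <= expR 1 :> R by have := expR_ge1Dx (1 : R); lra.
have e1q : expR 3 * q * expR 1 = 1.
  by rewrite mulrAC -expRD (_ : 3 + 1 = 4 :> R)//; ring.
have e3 : 1 <= expR 3 :> R by rewrite -expR0 ler_expR.
have qh : expR 3 * q <= 1 / 2.
  have e3q : 0 <= expR 3 * q by rewrite mulr_ge0 ?expR_ge0// ltW.
  nra.
have q2 : 2 * q <= 1 by nra.
have q8 : q <= 1 / 8.
  have e1 : expR 4 = expR 1 ^+ 4 :> R by rewrite -expRM_natl mulr1.
  have : 8 <= expR 4 :> R.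
    rewrite e1; apply: (@le_trans _ _ (2 ^+ 4)); first by lra.
    by rewrite lerXn2r ?nnegrE// expR_ge0.
  nra.
have qk : (2 * q) ^+ (k + k) <= (2 * q) ^+ 2.
  by apply: ler_wiXn2l => //; [rewrite mulr_ge0// ltW|exact: (leq_add k0 k0)].
have yk2 : (2 / 3) ^+ (k + k) <= ((2 / 3) `^ y) ^+ 2 :> R.
  rewrite exprD -expr2 lerXn2r ?nnegrE ?exprn_ge0 ?powR_ge0 ?divr_ge0//.
  rewrite -powR_mulrn ?divr_ge0// ger_powR//.
  by apply/andP; split; lra.
have pi2 : 2 <= pi :> R by have := @pihalf_ge1 R; lra.
have pw : (4 * D / c) ^+ (k + k) <= (2 / 3) ^+ (k + k) * (2 * q) ^+ 2.
  apply: (@le_trans _ _ ((2 / 3 * (2 * q)) ^+ (k + k))).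
    rewrite lerXn2r ?nnegrE //; first by rewrite divr_ge0 ?mulr_ge0 ?(ltW D0) ?(ltW c0).
    by rewrite !mulr_ge0 ?invr_ge0 ?(ltW q0).
  by rewrite exprMn ler_wpM2l// exprn_ge0// divr_ge0.
have P0 : 0 <= (4 * D / c) ^+ (k + k).
  by rewrite exprn_ge0// divr_ge0 ?mulr_ge0 ?(ltW D0) ?(ltW c0).
set Y := ((2 / 3) `^ y) ^+ 2 in yk2 *; set X := (2 / 3) ^+ (k + k) in yk2 pw.
have X0 : 0 <= X by rewrite exprn_ge0// divr_ge0.
rewrite [leRHS]mulrA ler_wpM2r ?invr_ge0 ?(ltW c0)//.
apply: (@le_trans _ _ (2 * ((expR 3 * (a + b)) * (Y * (2 * q) ^+ 2)))).
  rewrite -[leLHS]mulrA ler_wpM2l//; apply: ler_pM => //.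
  - by rewrite addr_ge0// mulr_ge0 ?expR_ge0.
  - by rewrite mulrDr lerD2r -[leLHS]mul1r ler_wpM2r.
  - by rewrite (le_trans pw)// ler_wpM2r// sqr_ge0.
have Y0 : 0 <= Y by exact: sqr_ge0.
have ab0 : 0 <= (a + b) * Y by rewrite mulr_ge0// addr_ge0.
have cst : 2 * expR 3 * (2 * q) ^+ 2 <= 2 * pi.
  apply: (@le_trans _ _ (8 * (expR 3 * q) * q)).
    by rewrite le_eqVlt; apply/orP; left; apply/eqP; ring.
  have e3q : 0 <= expR 3 * q by rewrite mulr_ge0 ?expR_ge0// ltW.
  nra.
rewrite (_ : _ * _ = (2 * expR 3 * (2 * q) ^+ 2) * ((a + b) * Y)); last by ring.
by rewrite [leRHS](_ : _ = 2 * pi * ((a + b) * Y)); [rewrite ler_wpM2r|ring].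
Qed.

(** Follows from Gamma(1/2) >= e^{-1}, sqrt 3 >= 1 and sqrt pi <= 2. *)
Lemma weight_constant_le :
  expR 2 / (2 * Num.sqrt 3 * Gamma (1 / 2) / Num.sqrt pi) <= expR 3 :> R.
Proof.
have Gge := @Gamma_half_ge R.
have G0 : 0 < Gamma (1 / 2) :> R by rewrite (lt_le_trans _ Gge)// expR_gt0.
have s3 : 1 <= Num.sqrt 3 :> R by rewrite -[leLHS]sqrtr1 ler_wsqrtr//; lra.
have sp0 : 0 < Num.sqrt pi :> R by rewrite sqrtr_gt0 pi_gt0.
have sp : Num.sqrt pi <= 2 :> R.
  have h4 : Num.sqrt (2 ^+ 2) = 2 :> R by rewrite sqrtr_sqr ger0_norm.
  rewrite -[leRHS]h4 ler_wsqrtr//; have := @pihalf_lt2 R; lra.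
rewrite ler_pdivrMr ?divr_gt0 ?mulr_gt0// ?(lt_le_trans ltr01 s3)//.
rewrite mulrA ler_pdivlMr//.
have e23 : expR 3 * expR (- 1) = expR 2 :> R.
  by rewrite -expRD; congr expR; ring.
apply: (@le_trans _ _ (expR 2 * 2)); first by rewrite ler_wpM2l ?expR_ge0.
rewrite -e23 -mulrA ler_wpM2l ?expR_ge0//.
have := expR_ge0 (- 1 : R); nra.
Qed.

End ErrorBound.

Section NativeSpace.
Context {R : realType}.
Notation mu := (@lebesgue_measure R).
Local Notation Re := (@complex.Re R).
Local Notation Im := (@complex.Im R).

Lemma termA_ge0 (c : R) (fhat : R -> R[i]) : 0 <= termA c fhat.
Proof.
rewrite mulr_ge0 ?div1r ?invr_ge0 ?(ltW besselK01_gt0)//.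
by apply: Rintegral_ge0 => xi _; exact: sqr_ge0.
Qed.

Lemma termB_ge0 (c sigma : R) (fhat : R -> R[i]) : 0 <= termB c sigma fhat.
Proof.
have G0 := @Gamma_half_gt0 R.
rewrite /termB; case: ifPn => // _; rewrite mulr_ge0//.
  by rewrite divr_ge0 ?sqrtr_ge0// mulr_ge0 ?(ltW G0)// mulr_ge0 ?sqrtr_ge0.
apply: Rintegral_ge0 => x _; rewrite mulr_ge0 ?expR_ge0//.
by rewrite mulr_ge0 ?sqr_ge0 ?sqrtr_ge0.
Qed.

(** The factor 1/(2 Gamma(1/2)) is pi/Gamma(1/2), from the Bessel representation of the form,
    divided by 2 pi, from the unitary normalization of the transform. *)
Lemma band_limited_functional_le (f fhat : R -> R[i]) sigma (c al be : R)
    (J : finType) (v p : J -> R) :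
  0 < c -> band_limited sigma f -> is_fourier f fhat -> al ^+ 2 + be ^+ 2 = 1 ->
  \sum_j v j * (al * Re (f (p j)) + be * Im (f (p j))) <=
  Num.sqrt ((termA c fhat + expR 3 * termB c sigma fhat) / (2 * Gamma (1 / 2)) *
    imq_form v p c).
Proof.
move=> c0 [cf _ [fh' fourier' fh'0]] fourier ab1.
have G0 := @Gamma_half_gt0 R.
have pi0 := pi_gt0 R.
have fh0 : {ae mu, forall xi : R, sigma < `|xi| -> fhat xi = 0}.
  have := fourier_unique cf fourier fourier'; move: fh'0.
  apply: filterS2; first exact: (ae_filter_ringOfSetsType mu).
  by move=> x h1 -> /h1.
have [_ fhL2 _] := fourier.
have [iW leW] := weighted_norm_le c0 fhL2 fh0.
have B0 := termB_ge0 c sigma fhat.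
set W := \int[mu]_xi _ in leW.
have W0 : 0 <= W.
  apply: Rintegral_ge0 => x _; rewrite mulr_ge0 ?sqr_ge0// ltW//.
  exact: bessel_weight_gt0.
set A := termA c fhat + _.
have WA : W <= A by rewrite (le_trans leW)// lerD2l ler_wpM2r// weight_constant_le.
set S := \sum_j _; set Q := imq_form v p c.
have Q0 : 0 <= Q by exact: imq_form_ge0.
have s0 : 0 < Num.sqrt (2 * pi) :> R by rewrite sqrtr_gt0 mulr_gt0.
have : Num.sqrt (2 * pi) * S <= Num.sqrt (A * (pi / Gamma (1 / 2) * Q)).
  apply: le_sqrt_mul; first exact: le_trans WA.
    by rewrite mulr_ge0// divr_ge0 ?(ltW pi0) ?(ltW G0).
  move=> eta eta0; rewrite mulrA.
  apply: le_trans (fourier_pairing_le cf fourier ab1 v p c0 iW eta0) _.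
  by rewrite lerD2r ler_wpM2l// ltW.
rewrite (_ : A * _ = 2 * pi * (A / (2 * Gamma (1 / 2)) * Q)).
  by rewrite [Num.sqrt (2 * pi * _)]sqrtrM ?mulr_ge0 ?(ltW pi0)// ler_pM2l.
by move: (pi : R) => P; field; rewrite lt0r_neq0.
Qed.

Lemma Re_Im_kernel_sum (h : R -> R) N (x : 'I_N -> R) (a : 'I_N -> R[i]) (al be t : R) :
  al * Re (kernel_sum h x a t) + be * Im (kernel_sum h x a t) =
  \sum_j (al * Re (a j) + be * Im (a j)) * h (t - x j).
Proof.
rewrite /kernel_sum.
have RD : {morph Re : u w / u + w} by case=> ? ? [].
have ID : {morph Im : u w / u + w} by case=> ? ? [].
rewrite (big_morph Re RD (erefl : Re 0 = 0)) (big_morph Im ID (erefl : Im 0 = 0)).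
rewrite !mulr_sumr -big_split; apply: eq_bigr => j _ /=.
by case: (a j) => u w /=; ring.
Qed.

End NativeSpace.

Unset Implicit Arguments.
Set Strict Implicit.
Set Printing Implicit Defensive.

Theorem theorem1p10 (R : realType) (c b0 sigma : R)
  (c_gt0 : 0 < c) (b0_gt0 : 0 < b0) (sigma_gt0 : 0 < sigma)
  (f : R -> R[i]) (f_band : band_limited sigma f)
  (fhat : R -> R[i]) (f_fhat : is_fourier f fhat)
  (E : set R) (E_itv : interval_of_length b0 E)
  (N : nat) (x : 'I_N -> R) (x_inj : injective x) (x_E : forall i, E (x i))
  (a : 'I_N -> R[i]) :
  let gamma1 : R := 2 in
  let rho : R := 1 in
  let Delta0 : R := 1 in
  let C := Num.max (2 * rho / c * expR (2 * gamma1)) (2 / (3 * b0)) in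
  let delta0 := 1 / (6 * C * gamma1) in
  let lambda := (2 / 3) `^ (1 / (6 * C * gamma1)) in
  let s := kernel_sum (imq c) x a in
  let delta := fill_distance (range x) E in
  (forall j, s (x j) = f (x j)) ->
  0 < delta -> delta <= delta0 ->
  forall t, E t ->
    Normc.normc (f t - s t) <=
      Num.sqrt (2 * pi) * Num.sqrt Delta0 * lambda `^ (1 / delta) *
      ((termA c fhat + termB c sigma fhat) / c) `^ (1 / 2).
Proof.
move=> gamma1 rho Delta0 C delta0 lambda s delta sx d0 dd0 t Et.
have cC : 2 / c * expR 4 <= C.
  by rewrite /C le_max /rho /gamma1 mulr1 (_ : 2 * 2 = 4 :> R) ?lexx//; ring.
have bC : 2 / (3 * b0) <= C by rewrite /C le_max lexx orbT.
have C0 : 0 < C by apply: lt_le_trans cC; rewrite mulr_gt0 ?expR_gt0// divr_gt0.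
pose y := 1 / (6 * C * gamma1) * (1 / delta).
have lamE : lambda `^ (1 / delta) = (2 / 3) `^ y by rewrite /lambda -powRrM.
have y1 : 1 <= y.
  by rewrite /y -/delta0 mulrA mulr1 ler_pdivlMr// mul1r.
have ydC : 12 * C * delta * y = 1.
  by rewrite /y /gamma1; field; rewrite !lt0r_neq0.
(* Here y = 1/(12 C delta). Rounding down gives k <= 2y, hence D <= 2/(3C); k >= y gives the rate,
   and holds because delta <= delta0 means y >= 1. *)
pose k := Num.truncn (2 * y).
have /andP[k1 k2] : k%:R <= 2 * y < k.+1%:R by apply: truncn_itv; lra.
have yk : y <= k%:R by move: k2; rewrite -natr1; lra.
have k0 : (0 < k)%N by rewrite -(ltr_nat R); lra.
pose D := 4 * k%:R * delta.
have D0 : 0 < D by rewrite !mulr_gt0// ltr0n.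
have DC : D <= 2 / (3 * C).
  rewrite ler_pdivlMr ?mulr_gt0//.
  have : 12 * C * delta * k%:R <= 12 * C * delta * (2 * y).
    by rewrite ler_wpM2l// !mulr_ge0// ltW.
  by rewrite mulrCA ydC /D; lra.
(* The second entry of the maximum [C] serves to fit the window into E. *)
have Db : D <= b0.
  apply: (le_trans DC); rewrite ler_pdivrMr ?mulr_gt0//.
  by move: bC; rewrite ler_pdivrMr ?mulr_gt0//; lra.
have [iota [zI zD]] := exists_nodes E_itv x_E d0 Db Et.
set A := termA c fhat; set B := termB c sigma fhat.
have A0 : 0 <= A by exact: termA_ge0.
have B0 : 0 <= B by exact: termB_ge0.
have G0 := @Gamma_half_gt0 R.
have ABc : 0 <= (A + B) / c by rewrite divr_ge0 ?addr_ge0 ?(ltW c_gt0).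
rewrite lamE /Delta0 sqrtr1 mulr1 [1 / 2]div1r powR12_sqrt//.
have rhs0 : 0 <= Num.sqrt (2 * pi) * (2 / 3) `^ y * Num.sqrt ((A + B) / c).
  by rewrite !mulr_ge0 ?sqrtr_ge0 ?powR_ge0.
(* A zero error has no direction to project on and is treated apart. *)
set n := Normc.normc _; have [->//|n0] := eqVneq n 0.
have n_gt0 : 0 < n by rewrite lt_neqAle eq_sym n0 normc_ge0.
pose e := f t - s t.
have n2 : n ^+ 2 = complex.Re e ^+ 2 + complex.Im e ^+ 2 by exact: sqr_normc.
pose al := complex.Re e / n; pose be := complex.Im e / n.
have ab1 : al ^+ 2 + be ^+ 2 = 1.
  by rewrite !expr_div_n -mulrDl -n2 divff// expf_neq0.
pose phi z := al * complex.Re (f z) + be * complex.Im (f z).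
pose coef j := al * complex.Re (a j) + be * complex.Im (a j).
have sE z : al * complex.Re (s z) + be * complex.Im (s z) =
    \sum_j coef j * imq c (z - x j) by exact: Re_Im_kernel_sum.
have nE : n = phi t - \sum_j coef j * imq c (t - x j).
  rewrite -sE /phi (_ : _ - _ = al * complex.Re e + be * complex.Im e).
    rewrite /al /be mulrAC [_ / n * complex.Im e]mulrAC -mulrDl -!expr2 -n2.
    by rewrite expr2 mulfK.
  by rewrite /e; case: (f t) (s t) => u w [u' w'] /=; ring.
pose K := (A + expR 3 * B) / (2 * Gamma (1 / 2)).
have K0 : 0 <= K.
  apply: divr_ge0; first by rewrite addr_ge0// mulr_ge0// expR_ge0.
  by rewrite mulr_ge0// ltW.
have := @interpolation_error_le R phi c K N x coef k
  (lagrange_weight (x \o iota) t) iota t c_gt0 K0.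
rewrite /= -nE => /(_ (fun J v p => band_limited_functional_le v p c_gt0 f_band f_fhat ab1)).
move=> /(_ _)/le_trans; apply.
  by move=> j; rewrite -sE sx.
have -> : Num.sqrt (2 * pi) * (2 / 3) `^ y * Num.sqrt ((A + B) / c) =
    Num.sqrt (2 * pi * ((2 / 3) `^ y) ^+ 2 * ((A + B) / c)).
  have pi20 : 0 <= 2 * pi :> R by rewrite mulr_ge0// pi_ge0.
  rewrite [RHS]sqrtrM; last by rewrite mulr_ge0 ?sqr_ge0.
  by congr (_ * _); rewrite [RHS]sqrtrM// sqrtr_sqr ger0_norm ?powR_ge0.
apply: ler_wsqrtr; apply: le_trans (numeric_bound c_gt0 D0 k0 cC DC yk A0 B0).
have zI' : injective (x \o iota) by [].
apply: (le_trans (ler_wpM2l K0 (imq_form_error_le c_gt0 (ltW D0) zI' zD))).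
(* The Gamma(1/2) of the kernel cancels against the one in [K]. *)
rewrite /K le_eqVlt; apply/orP; left; apply/eqP.
move: (_ ^+ (k + k)) (A + _ * B) (Gamma (1 / 2)) G0 => P A' G G0.
by field; rewrite !lt0r_neq0.
Qed.
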